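(* Let $\mathcal{T}$ be a topos and let $\mathcal{B}(\mathcal{T})$ be the smallest logical class of morphisms of $\mathcal{T}$ containing the canonical monomorphism $b:1+1\to\Omega$. Then $\mathsf{Map}(\mathsf{Span}_{\mathcal{B}(\mathcal{T})}(\mathcal{T}))$ is a Boolean topos.
   Context: Topos means elementary topos; $\mathcal{E},\mathcal{M}$ are its classes of epimorphisms and monomorphisms; $b:1+1\to\Omega$ is induced by true and false, and a topos is Boolean when $b$ is an isomorphism. A class $\mathcal{W}$ of morphisms of $\mathcal{T}$ is a logical class if: it is closed under composition and pullbacks and contains all isomorphisms; $\mathcal{E}\subseteq\mathcal{W}$; for each $w\in\mathcal{W}$ the mono part of its epi-mono factorization is in $\mathcal{W}$; and for any monomorphism $m:X\to Y$ in $\mathcal{W}$, any monomorphism $f:Y\to Z$ and any morphism $g:Z\to Z'$, the morphism $\forall_g m$ is in $\mathcal{W}$. Here $\forall_g$ is the right adjoint to pullback of subobjects along $g$, and $\forall_g m$ is the monomorphism from the domain of $\forall_g(fm)$ to the domain of $\forall_g f$ expressing $\forall_g(fm)\le\forall_g f$. For such $\mathcal{W}$, $\sim_{\mathcal{W}}$ is the equivalence relation on spans generated by: $(f,g)\le_{\mathcal{W}}(f',g')$ iff there is $w\in\mathcal{W}$ with $f'w=f$, $g'w=g$. $\mathsf{Span}_{\mathcal{W}}(\mathcal{T})$ is the category with the objects of $\mathcal{T}$ and morphisms the classes $[f,g]_{\mathcal{W}}$ of spans ($f:D\to A$, $g:D\to B$ arbitrary morphisms of $\mathcal{T}$), composed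 by pullback. It carries the structure: $[f,g]^{\circ}=[g,f]$; $[f,g]\cap[h,k]=[fp,gp]$, where $p$ is the projection to the domain of $f$ of the pullback of $\langle f,g\rangle$ and $\langle h,k\rangle$; $\alpha\le\beta$ iff $\alpha\cap\beta=\alpha$. A map is a morphism $r$ with $1\le r^{\circ}r$ and $rr^{\circ}\le1$; $\mathsf{Map}(-)$ denotes the subcategory of maps. *)

(* Defs.v *)
From Corelib Require Import ssreflect.
From Stdlib Require Import Relations.
From Stdlib Require Import ClassicalEpsilon FunctionalExtensionality.
From Stdlib Require Import PropExtensionality ProofIrrelevance.

Set Implicit Arguments.
Unset Strict Implicit.
Unset Printing Implicit Defensive.

(** * Categories *)

Record category := Category {
  obj :> Type;
  hom : obj -> obj -> Type;
  idm : forall A, hom A A;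
  comp : forall A B C, hom B C -> hom A B -> hom A C;
  comp_idl : forall A B (f : hom A B), comp (idm B) f = f;
  comp_idr : forall A B (f : hom A B), comp f (idm A) = f;
  comp_assoc : forall A B C D (h : hom C D) (g : hom B C) (f : hom A B),
      comp h (comp g f) = comp (comp h g) f
}.

Arguments hom {c} A B.
Arguments idm {c} A.
Arguments comp {c A B C} g f.

Declare Scope cat_scope.
Delimit Scope cat_scope with cat.
Open Scope cat_scope.

Notation "g ∘ f" := (comp g f)
  (at level 40, left associativity, format "g  ∘  f") : cat_scope.

Definition monic (C : category) (A B : C) (m : hom A B) : Prop :=
  forall X (x y : hom X A), m ∘ x = m ∘ y -> x = y.

Definition epic (C : category) (A B : C) (e : hom A B) : Prop :=
  forall X (x y : hom B X), x ∘ e = y ∘ e -> x = y.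

Definition is_iso (C : category) (A B : C) (f : hom A B) : Prop :=
  exists g : hom B A, g ∘ f = idm A /\ f ∘ g = idm B.

Record span (C : category) (A B : C) := Span {
  apex : C;
  lft : hom apex A;
  rgt : hom apex B
}.

Arguments Span {C A B apex} lft rgt.
Arguments apex {C A B} s.
Arguments lft {C A B} s.
Arguments rgt {C A B} s.

(** * Limits, exponentials, subobject classifiers *)

Definition is_terminal (C : category) (I : C) : Prop :=
  forall X : C, exists! f : hom X I, True.

Definition is_initial (C : category) (O : C) : Prop :=
  forall X : C, exists! f : hom O X, True.

Definition is_product (C : category) (A B : C) (p : span A B) : Prop :=
  forall s : span A B,
    exists! u : hom (apex s) (apex p), lft p ∘ u = lft s /\ rgt p ∘ u = rgt s.

Definition is_coproduct (C : category) (A B S : C)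
    (i : hom A S) (j : hom B S) : Prop :=
  forall X (f : hom A X) (g : hom B X),
    exists! u : hom S X, u ∘ i = f /\ u ∘ j = g.

Definition is_pullback (C : category) (A B D : C) (f : hom A D) (g : hom B D)
    (p : span A B) : Prop :=
  f ∘ lft p = g ∘ rgt p /\
  forall s : span A B, f ∘ lft s = g ∘ rgt s ->
    exists! u : hom (apex s) (apex p), lft p ∘ u = lft s /\ rgt p ∘ u = rgt s.

(* [ev] is evaluation on the product [P] of [E] and [A]; the transpose [k] of
   [h : X x A -> B] is the unique morphism with [ev (k x 1) = h]. *)
Definition is_exponential (C : category) (A B E : C) (P : span E A)
    (ev : hom (apex P) B) : Prop :=
  is_product P /\
  forall (X : C) (Q : span X A) (h : hom (apex Q) B), is_product Q ->
    exists! k : hom X E, exists kx1 : hom (apex Q) (apex P),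
      lft P ∘ kx1 = k ∘ lft Q /\ rgt P ∘ kx1 = rgt Q /\ ev ∘ kx1 = h.

(* [classifies t m chi]: the square exhibiting [m] as the pullback of [t]
   along [chi]. *)
Definition classifies (C : category) (I Om X Y : C) (t : hom I Om)
    (m : hom X Y) (chi : hom Y Om) : Prop :=
  exists x : hom X I, is_pullback chi t (Span m x).

Definition is_subobject_classifier (C : category) (I Om : C) (t : hom I Om)
    : Prop :=
  is_terminal I /\
  forall (X Y : C) (m : hom X Y), monic m ->
    exists! chi : hom Y Om, classifies t m chi.

(** * Elementary toposes *)

Record topos (C : category) : Prop := Topos {
  topos_terminal : exists I : C, is_terminal I;
  topos_product : forall A B : C, exists p : span A B, is_product p;
  topos_pullback : forall (A B D : C) (f : hom A D) (g : hom B D),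
      exists p : span A B, is_pullback f g p;
  topos_exponential : forall A B : C,
      exists (E : C) (P : span E A) (ev : hom (apex P) B), is_exponential ev;
  topos_classifier : exists (I Om : C) (t : hom I Om),
      is_subobject_classifier t
}.

(* false : 1 -> Omega is the classifying morphism of 0 -> 1. *)
Definition is_false (C : category) (I Om : C) (t f : hom I Om) : Prop :=
  exists (O : C) (z : hom O I), is_initial O /\ classifies t z f.

(* [b] is the morphism 1 + 1 -> Omega induced by true and false, for some
   choice of 1, Omega, true and of the coproduct 1 + 1; it is determined up to
   isomorphism. *)
Definition canonical_b (C : category) (S Om : C) (b : hom S Om) : Prop :=
  exists (I : C) (t f : hom I Om) (i j : hom I S),
    is_subobject_classifier t /\ is_false t f /\ is_coproduct i j /\
    b ∘ i = t /\ b ∘ j = f.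

Definition boolean_topos (C : category) : Prop :=
  topos C /\
  exists (S Om : C) (b : hom S Om), canonical_b b /\ is_iso b.

(** * Logical classes *)

Definition mor_class (C : category) := forall A B : C, hom A B -> Prop.

(* Order of subobjects of [Z], for monomorphisms representing them. *)
Definition sub_le (C : category) (U V Z : C) (k : hom U Z) (h : hom V Z)
    : Prop :=
  exists u : hom U V, h ∘ u = k.

(* The monomorphism [h] represents the subobject forall_g f: for every
   subobject [k] of [Z'], k <= h iff g^* k <= f. *)
Definition is_forall (C : category) (Y Z Z' V : C) (g : hom Z Z')
    (f : hom Y Z) (h : hom V Z') : Prop :=
  monic h /\
  forall (U : C) (k : hom U Z') (p : span Z U),
    monic k -> is_pullback g k p -> (sub_le k h <-> sub_le (lft p) f).

Record logical_class (C : category) (W : mor_class C) : Prop := LogicalClass {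
  lc_iso : forall (A B : C) (f : hom A B), is_iso f -> W A B f;
  lc_comp : forall (A B D : C) (g : hom B D) (f : hom A B),
      W B D g -> W A B f -> W A D (g ∘ f);
  lc_pullback : forall (A B D : C) (f : hom A D) (w : hom B D) (p : span A B),
      is_pullback f w p -> W B D w -> W (apex p) A (lft p);
  lc_epi : forall (A B : C) (e : hom A B), epic e -> W A B e;
  lc_mono_part : forall (A J B : C) (e : hom A J) (m : hom J B),
      epic e -> monic m -> W A B (m ∘ e) -> W J B m;
  lc_forall : forall (X Y Z Z' V V' : C) (m : hom X Y) (f : hom Y Z)
      (g : hom Z Z') (h : hom V Z') (h' : hom V' Z') (u : hom V V'),
      monic m -> W X Y m -> monic f ->
      is_forall g (f ∘ m) h -> is_forall g f h' -> h' ∘ u = h -> W V V' u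
}.

(* B(T): the smallest logical class containing b. *)
Definition boolean_class (C : category) : mor_class C :=
  fun A B f => forall W : mor_class C, logical_class W ->
    (forall (S Om : C) (b : hom S Om), canonical_b b -> W S Om b) -> W A B f.

Arguments boolean_class C : clear implicits.

Lemma boolean_class_b (C S Om : _) (b : @hom C S Om) :
  canonical_b b -> boolean_class C S Om b.
Proof. by move=> Hb W _; apply. Qed.

Lemma boolean_class_logical (C : category) : logical_class (boolean_class C).
Proof.
split.
- by move=> A B f fi W WL Wb; apply: (lc_iso WL).
- by move=> A B D g f Wg Wf W WL Wb; apply: (lc_comp WL); [apply: Wg | apply: Wf].
- by move=> A B D f w p pb Ww W WL Wb; apply: (lc_pullback WL pb); apply: Ww.
- by move=> A B e he W WL Wb; apply: (lc_epi WL).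
- move=> A J B e m he hm Wme W WL Wb.
  by apply: (lc_mono_part WL he hm); apply: Wme.
- move=> X Y Z Z' V V' m f g h h' u hm Wm hf H1 H2 e W WL Wb.
  by apply: (lc_forall WL hm _ hf H1 H2 e); apply: Wm.
Qed.

(** * Quotient by an equivalence relation *)

Definition quotient (X : Type) (R : X -> X -> Prop) : Type :=
  {P : X -> Prop | exists x, P = R x}.

Definition cls (X : Type) (R : X -> X -> Prop) (x : X) : quotient R :=
  exist _ (R x) (ex_intro _ x eq_refl).

Definition repr (X : Type) (R : X -> X -> Prop) (q : quotient R) : X :=
  proj1_sig (constructive_indefinite_description _ (proj2_sig q)).

Lemma sig_eq (X : Type) (P : X -> Prop) (a b : sig P) :
  proj1_sig a = proj1_sig b -> a = b.
Proof.
case: a b => [a pa] [b pb] /= e; move: pa; rewrite e => pa.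
by rewrite (proof_irrelevance _ pa pb).
Qed.

Lemma repr_cls (X : Type) (R : X -> X -> Prop) (q : quotient R) :
  cls R (repr q) = q.
Proof.
apply: sig_eq; rewrite /repr /=.
by case: (constructive_indefinite_description _ _).
Qed.

Lemma clsP (X : Type) (R : X -> X -> Prop) (x y : X) :
  equivalence _ R -> cls R x = cls R y <-> R x y.
Proof.
move=> [Rr Rt Rs]; split.
- by move=> /(f_equal (@proj1_sig _ _)) /= ->; apply: Rr.
- move=> xy; apply: sig_eq => /=.
  apply: functional_extensionality => z; apply: propositional_extensionality.
  by split; apply: Rt => //; apply: Rs.
Qed.

Lemma cls_repr_rel (X : Type) (R : X -> X -> Prop) (x : X) :
  equivalence _ R -> R (repr (cls R x)) x.
Proof. by move=> E; apply/(clsP _ _ E); apply: repr_cls. Qed.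

(** * Pullbacks *)

Definition flip (C : category) (A B : C) (s : span A B) : span B A :=
  Span (rgt s) (lft s).

Lemma pullback_flip (C : category) (A B D : C) (f : hom A D) (g : hom B D)
    (p : span A B) :
  is_pullback f g p -> is_pullback g f (flip p).
Proof.
move=> [e H]; split=> // s es.
have [u [[u1 u2] uu]] := H (flip s) (eq_sym es).
by exists u; split=> // v [v1 v2]; apply: uu.
Qed.

(* Two pullback squares side by side form a pullback square. *)
Lemma pullback_paste (C : category) (A B D E : C)
    (f : hom A B) (g : hom B E) (h : hom D E) (q : span B D)
    (p : span A (apex q)) :
  is_pullback g h q -> is_pullback f (lft q) p ->
  is_pullback (g ∘ f) h (Span (lft p) (rgt q ∘ rgt p)).
Proof.
move=> [eq Hq] [ep Hp]; split=> /=.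
  by rewrite -comp_assoc ep !comp_assoc eq.
move=> s es.
have [v [[v1 v2] vu]] : exists! v, lft q ∘ v = f ∘ lft s /\ rgt q ∘ v = rgt s.
  by apply: (Hq (Span (f ∘ lft s) (rgt s))); rewrite /= comp_assoc.
have [u [[u1 u2] uu]] : exists! u, lft p ∘ u = lft s /\ rgt p ∘ u = v.
  by apply: (Hp (Span (lft s) v)).
exists u; split=> [|u' [u1' u2']]; first by rewrite -comp_assoc u2.
apply: uu; split=> //; apply: eq_sym; apply: vu; split.
  by rewrite comp_assoc -ep -comp_assoc u1'.
by rewrite comp_assoc.
Qed.

Lemma pullback_idl (C : category) (A B : C) (f : hom A B) :
  is_pullback (idm B) f (Span f (idm A)).
Proof.
split=> [|s]; rewrite /= ?comp_idl ?comp_idr // => e.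
exists (rgt s); split=> [|u [_ u2]]; first by rewrite comp_idl.
by rewrite -u2 comp_idl.
Qed.

Lemma unique_eq (X : Type) (P : X -> Prop) (x y : X) :
  (exists! z, P z) -> P x -> P y -> x = y.
Proof. by move=> [z [_ zu]] /zu <- /zu <-. Qed.

Lemma pullback_iso (C : category) (A B D : C) (f : hom A D) (g : hom B D)
    (p q : span A B) :
  is_pullback f g p -> is_pullback f g q ->
  exists u : hom (apex p) (apex q),
    is_iso u /\ lft q ∘ u = lft p /\ rgt q ∘ u = rgt p.
Proof.
move=> [ep Hp] [eq Hq].
have [u [[u1 u2] _]] := Hq p ep.
have [v [[v1 v2] _]] := Hp q eq.
exists u; split=> //; exists v; split.
- by apply: (unique_eq (Hp p ep)); rewrite ?comp_idr // !comp_assoc v1 v2.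
- by apply: (unique_eq (Hq q eq)); rewrite ?comp_idr // !comp_assoc u1 u2.
Qed.

(** * The category of spans modulo a logical class *)

Definition span_le (C : category) (W : mor_class C) (A B : C)
    (s t : span A B) : Prop :=
  exists w : hom (apex s) (apex t),
    W _ _ w /\ lft t ∘ w = lft s /\ rgt t ∘ w = rgt s.

Definition span_sim (C : category) (W : mor_class C) (A B : C)
    : span A B -> span A B -> Prop :=
  clos_refl_sym_trans _ (@span_le C W A B).

Lemma span_sim_equiv (C : category) (W : mor_class C) (A B : C) :
  equivalence _ (@span_sim C W A B).
Proof.
split.
- by move=> s; apply: rst_refl.
- by move=> s t u; apply: rst_trans.
- by move=> s t; apply: rst_sym.
Qed.

Definition span_hom (C : category) (W : mor_class C) (A B : C) : Type :=
  quotient (@span_sim C W A B).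

(* The class [f, g]_W of the span s = (f, g). *)
Notation scls W s := (cls (@span_sim _ W _ _) s).

Section SpanCategory.

Variables (C : category) (hC : topos C).

(* Chosen limits, used to build representatives only: see [span_comp_any] and
   [span_meet_any]. *)
Definition pullback (A B D : C) (f : hom A D) (g : hom B D) : span A B :=
  proj1_sig (constructive_indefinite_description _ (topos_pullback hC f g)).

Lemma pullbackP (A B D : C) (f : hom A D) (g : hom B D) :
  is_pullback f g (pullback f g).
Proof. by rewrite /pullback; case: (constructive_indefinite_description _ _). Qed.

Definition product (A B : C) : span A B :=
  proj1_sig (constructive_indefinite_description _ (topos_product hC A B)).

Lemma productP (A B : C) : is_product (product A B).
Proof. by rewrite /product; case: (constructive_indefinite_description _ _). Qed.

(* The morphism <f, g> : D -> A x B. *)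
Definition pairing (A B : C) (s : span A B) : hom (apex s) (apex (product A B)) :=
  proj1_sig (constructive_indefinite_description _ (productP s)).

Lemma pairP (A B : C) (s : span A B) :
  lft (product A B) ∘ pairing s = lft s /\ rgt (product A B) ∘ pairing s = rgt s.
Proof.
rewrite /pairing; case: (constructive_indefinite_description _ _) => u [H _] /=.
exact: H.
Qed.

Lemma pair_comp (A B : C) (s : span A B) (X : C) (u : hom X (apex s)) :
  pairing s ∘ u = pairing (Span (lft s ∘ u) (rgt s ∘ u)).
Proof.
have [s1 s2] := pairP s.
apply: (unique_eq (productP (Span (lft s ∘ u) (rgt s ∘ u)))).
  by rewrite !comp_assoc s1 s2.
exact: pairP.
Qed.

Definition span_id (A : C) : span A A := Span (idm A) (idm A).

Definition span_comp (A B D : C) (t : span B D) (s : span A B) : span A D :=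
  let p := pullback (rgt s) (lft t) in Span (lft s ∘ lft p) (rgt t ∘ rgt p).

Definition span_meet (A B : C) (s t : span A B) : span A B :=
  let p := lft (pullback (pairing s) (pairing t)) in Span (lft s ∘ p) (rgt s ∘ p).

Variables (W : mor_class C) (hW : logical_class W).

Definition sp_id (A : C) : span_hom W A A := scls W (span_id A).

Definition sp_comp (A B D : C) (b : span_hom W B D) (a : span_hom W A B)
    : span_hom W A D :=
  scls W (span_comp (repr b) (repr a)).

Definition sp_conv (A B : C) (a : span_hom W A B) : span_hom W B A :=
  scls W (flip (repr a)).

Definition sp_meet (A B : C) (a b : span_hom W A B) : span_hom W A B :=
  scls W (span_meet (repr a) (repr b)).

Definition sp_le (A B : C) (a b : span_hom W A B) : Prop := sp_meet a b = a.

(** ** Independence of representatives *)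

Lemma cls_le (A B : C) (s t : span A B) : span_le W s t -> (scls W s) = (scls W t).
Proof.
by move=> H; apply/(clsP _ _ (span_sim_equiv W A B)); apply: rst_step.
Qed.

(* A function on spans invariant under [span_le] is invariant under
   [span_sim]. *)
Lemma sim_ind (A B : C) (X : Type) (F : span A B -> X) :
  (forall s t, span_le W s t -> F s = F t) ->
  forall s t, span_sim W s t -> F s = F t.
Proof.
move=> H s t; elim=> [x y /H //|//|x y _ -> //|x y z _ -> _ -> //].
Qed.

Lemma span_comp_any (A B D : C) (t : span B D) (s : span A B)
    (p : span (apex s) (apex t)) :
  is_pullback (rgt s) (lft t) p ->
  (scls W (span_comp t s)) = (scls W (Span (lft s ∘ lft p) (rgt t ∘ rgt p))).
Proof.
move=> Hp; apply: cls_le.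
have [u [ui [u1 u2]]] := pullback_iso (pullbackP (rgt s) (lft t)) Hp.
exists u => /=; split; first exact: (lc_iso hW).
by rewrite -!comp_assoc u1 u2.
Qed.

Lemma span_meet_any (A B : C) (s t : span A B) (p : span (apex s) (apex t)) :
  is_pullback (pairing s) (pairing t) p ->
  (scls W (span_meet s t)) = (scls W (Span (lft s ∘ lft p) (rgt s ∘ lft p))).
Proof.
move=> Hp; apply: cls_le.
have [u [ui [u1 u2]]] := pullback_iso (pullbackP (pairing s) (pairing t)) Hp.
exists u => /=; split; first exact: (lc_iso hW).
by rewrite -!comp_assoc u1.
Qed.

Lemma pair_legs (A B X : C) (s t : span A B)
    (u : hom X (apex s)) (v : hom X (apex t)) :
  pairing s ∘ u = pairing t ∘ v <->
  lft s ∘ u = lft t ∘ v /\ rgt s ∘ u = rgt t ∘ v.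
Proof.
have [s1 s2] := pairP s; have [t1 t2] := pairP t.
split=> [e|[e1 e2]].
  by rewrite -s1 -s2 -t1 -t2 -!comp_assoc e.
by rewrite !pair_comp e1 e2.
Qed.

Lemma cls_flip (A B : C) (s t : span A B) :
  (scls W s) = (scls W t) -> (scls W (flip s)) = (scls W (flip t)).
Proof.
move/(clsP _ _ (span_sim_equiv W A B)); move: s t.
apply: (sim_ind (F := fun s => (scls W (flip s)))) => s t [w [Ww [w1 w2]]].
by apply: cls_le; exists w.
Qed.

Lemma span_comp_flip (A B D : C) (t : span B D) (s : span A B) :
  (scls W (flip (span_comp t s))) = (scls W (span_comp (flip s) (flip t))).
Proof.
have H := pullback_flip (pullbackP (rgt s) (lft t)).
by rewrite (span_comp_any (t := flip s) (s := flip t) H).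
Qed.

Lemma cls_comp_r (A B D : C) (t : span B D) (s s' : span A B) :
  (scls W s) = (scls W s') -> (scls W (span_comp t s)) = (scls W (span_comp t s')).
Proof.
move/(clsP _ _ (span_sim_equiv W A B)); move: s s'.
apply: (sim_ind (F := fun s => (scls W (span_comp t s)))) => s s' [w [Ww [w1 w2]]].
have Hp := pullbackP (rgt s') (lft t).
have Hx := pullbackP w (lft (pullback (rgt s') (lft t))).
have := pullback_paste Hp Hx; rewrite w2 => /span_comp_any ->.
apply: cls_le.
exists (rgt (pullback w (lft (pullback (rgt s') (lft t))))) => /=.
split; first exact: (lc_pullback hW (pullback_flip Hx)).
case: Hx => ex _.
by rewrite -w1 -!comp_assoc ex.
Qed.

Lemma cls_comp (A B D : C) (t t' : span B D) (s s' : span A B) :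
  (scls W t) = (scls W t') -> (scls W s) = (scls W s') ->
  (scls W (span_comp t s)) = (scls W (span_comp t' s')).
Proof.
move=> et es; rewrite (cls_comp_r t es).
apply: (cls_flip (s := flip (span_comp t s')) (t := flip (span_comp t' s'))).
by rewrite !span_comp_flip; apply: cls_comp_r; apply: cls_flip.
Qed.

Lemma span_meetC (A B : C) (s t : span A B) :
  (scls W (span_meet s t)) = (scls W (span_meet t s)).
Proof.
have H := pullbackP (pairing t) (pairing s).
rewrite (span_meet_any (pullback_flip H)) /=.
have [e1 e2] : lft t ∘ lft (pullback (pairing t) (pairing s))
             = lft s ∘ rgt (pullback (pairing t) (pairing s)) /\
             rgt t ∘ lft (pullback (pairing t) (pairing s))
             = rgt s ∘ rgt (pullback (pairing t) (pairing s)).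
  by apply/pair_legs; case: H.
by rewrite /span_meet e1 e2.
Qed.

Lemma cls_meet_l (A B : C) (t s s' : span A B) :
  (scls W s) = (scls W s') -> (scls W (span_meet s t)) = (scls W (span_meet s' t)).
Proof.
move/(clsP _ _ (span_sim_equiv W A B)); move: s s'.
apply: (sim_ind (F := fun s => (scls W (span_meet s t)))) => s s' [w [Ww [w1 w2]]].
have ew : pairing s' ∘ w = pairing s by rewrite pair_comp w1 w2; case: (s).
have Hp := pullbackP (pairing s') (pairing t).
have Hx := pullbackP w (lft (pullback (pairing s') (pairing t))).
have := pullback_paste Hp Hx; rewrite ew => /span_meet_any ->.
apply: cls_le.
exists (rgt (pullback w (lft (pullback (pairing s') (pairing t))))) => /=.
split; first exact: (lc_pullback hW (pullback_flip Hx)).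
case: Hx => ex _.
by rewrite -w1 -w2 -!comp_assoc ex.
Qed.

Lemma cls_meet (A B : C) (s s' t t' : span A B) :
  (scls W s) = (scls W s') -> (scls W t) = (scls W t') ->
  (scls W (span_meet s t)) = (scls W (span_meet s' t')).
Proof.
move=> es et; rewrite (cls_meet_l t es) span_meetC (cls_meet_l s' et).
exact: span_meetC.
Qed.

Lemma sp_compE (A B D : C) (t : span B D) (s : span A B) :
  sp_comp (scls W t) (scls W s) = (scls W (span_comp t s)).
Proof. by apply: cls_comp; apply: repr_cls. Qed.

Lemma sp_convE (A B : C) (s : span A B) : sp_conv (scls W s) = (scls W (flip s)).
Proof. by apply: cls_flip; apply: repr_cls. Qed.

Lemma sp_meetE (A B : C) (s t : span A B) :
  sp_meet (scls W s) (scls W t) = (scls W (span_meet s t)).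
Proof. by apply: cls_meet; apply: repr_cls. Qed.

(** ** Category laws *)

Lemma sp_comp_idl (A B : C) (a : span_hom W A B) : sp_comp (sp_id B) a = a.
Proof.
rewrite -(repr_cls a) sp_compE.
rewrite (span_comp_any (t := span_id B) (s := repr a)
           (pullback_flip (pullback_idl (rgt (repr a))))) /=.
by rewrite comp_idl comp_idr; case: (repr a).
Qed.

Lemma sp_comp_idr (A B : C) (a : span_hom W A B) : sp_comp a (sp_id A) = a.
Proof.
rewrite -(repr_cls a) sp_compE.
rewrite (span_comp_any (t := repr a) (s := span_id A)
           (pullback_idl (lft (repr a)))) /=.
by rewrite comp_idl comp_idr; case: (repr a).
Qed.

Lemma sp_comp_assoc (A B D E : C) (c : span_hom W D E) (b : span_hom W B D)
    (a : span_hom W A B) :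
  sp_comp c (sp_comp b a) = sp_comp (sp_comp c b) a.
Proof.
rewrite -(repr_cls a) -(repr_cls b) -(repr_cls c) !sp_compE.
move: (repr a) (repr b) (repr c) => s t u.
have Hp := pullbackP (rgt s) (lft t).
have Hq := pullbackP (rgt t) (lft u).
have Hx := pullbackP (rgt (pullback (rgt s) (lft t)))
                     (lft (pullback (rgt t) (lft u))).
rewrite (span_comp_any (t := u) (s := span_comp t s) (pullback_paste Hq Hx)).
have H := pullback_paste (pullback_flip Hp) (pullback_flip Hx).
rewrite (span_comp_any (t := span_comp u t) (s := s) (pullback_flip H)) /=.
by rewrite !comp_assoc.
Qed.

(* A span (f : D -> A, g : D -> B) represents a morphism A -> B, and
   composites are written in the applicative order. *)
Definition SpanW : category :=
  @Category C (span_hom W) sp_id sp_comp sp_comp_idl sp_comp_idr sp_comp_assoc.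

(** ** The order on spans and maps *)

Lemma sp_meet_assoc (A B : C) (a b c : span_hom W A B) :
  sp_meet (sp_meet a b) c = sp_meet a (sp_meet b c).
Proof.
rewrite -(repr_cls a) -(repr_cls b) -(repr_cls c) !sp_meetE.
move: (repr a) (repr b) (repr c) => s t u.
have Hp := pullbackP (pairing s) (pairing t).
have Hq := pullbackP (pairing t) (pairing u).
have Hx := pullbackP (rgt (pullback (pairing s) (pairing t)))
                     (lft (pullback (pairing t) (pairing u))).
have e1 : pairing (span_meet s t) = pairing t ∘ rgt (pullback (pairing s) (pairing t)).
  by case: Hp => <- _; rewrite pair_comp.
have e2 : pairing (span_meet t u) = pairing t ∘ lft (pullback (pairing t) (pairing u)).
  by rewrite pair_comp.
have H1 := pullback_paste Hq Hx; rewrite -e1 in H1.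
rewrite (span_meet_any (s := span_meet s t) (t := u) H1).
have H2 := pullback_paste (pullback_flip Hp) (pullback_flip Hx).
rewrite -[X in is_pullback X]/(pairing t ∘ lft (pullback (pairing t) (pairing u))) in H2.
rewrite -e2 in H2.
rewrite (span_meet_any (s := s) (t := span_meet t u) (pullback_flip H2)) /=.
by rewrite !comp_assoc.
Qed.

Lemma sp_leP (A B : C) (a b : span_hom W A B) :
  sp_le a b <-> exists (s t : span A B) (u : hom (apex s) (apex t)),
    a = (scls W s) /\ b = (scls W t) /\ lft t ∘ u = lft s /\ rgt t ∘ u = rgt s.
Proof.
rewrite /sp_le; split=> [<-|[s [t [u [-> [-> [u1 u2]]]]]]].
  have H := pullbackP (pairing (repr a)) (pairing (repr b)).
  exists (span_meet (repr a) (repr b)), (repr b).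
  exists (rgt (pullback (pairing (repr a)) (pairing (repr b)))).
  have [e1 e2] := proj1 (pair_legs _ _) (proj1 H).
  by rewrite -sp_meetE !repr_cls.
rewrite sp_meetE; apply: cls_le.
have [e H] := pullbackP (pairing s) (pairing t).
have es : pairing s ∘ idm _ = pairing t ∘ u by apply/pair_legs; rewrite !comp_idr u1 u2.
have [v [[/= v1 _] _]] := H (Span (idm _) u) es.
exists (lft (pullback (pairing s) (pairing t))); split=> //.
apply: (lc_epi hW) => X x y exy.
by rewrite -(comp_idr x) -(comp_idr y) -v1 !comp_assoc exy.
Qed.

Lemma sp_le_refl (A B : C) (a : span_hom W A B) : sp_le a a.
Proof.
apply/sp_leP; exists (repr a), (repr a), (idm _).
by rewrite repr_cls !comp_idr.
Qed.

Lemma sp_le_trans (A B : C) (a b c : span_hom W A B) :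
  sp_le a b -> sp_le b c -> sp_le a c.
Proof. by rewrite /sp_le => ab bc; rewrite -ab sp_meet_assoc bc. Qed.

Lemma sp_le_comp (A B D : C) (b b' : span_hom W B D) (a a' : span_hom W A B) :
  sp_le b b' -> sp_le a a' -> sp_le (sp_comp b a) (sp_comp b' a').
Proof.
move=> /sp_leP [t [t' [v [-> [-> [v1 v2]]]]]].
move=> /sp_leP [s [s' [u [-> [-> [u1 u2]]]]]].
rewrite !sp_compE; apply/sp_leP; exists (span_comp t s), (span_comp t' s').
have [e _] := pullbackP (rgt s) (lft t).
have [e' H'] := pullbackP (rgt s') (lft t').
have [|k [[/= k1 k2] _]] := H' (Span (u ∘ lft (pullback (rgt s) (lft t)))
                                (v ∘ rgt (pullback (rgt s) (lft t)))).
  by rewrite /= !comp_assoc u2 v1.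
exists k; split=> //; split=> //=.
by rewrite -!comp_assoc k1 k2 !comp_assoc u1 v2.
Qed.

Lemma sp_conv_id (A : C) : sp_conv (sp_id A) = sp_id A.
Proof. by rewrite sp_convE. Qed.

Lemma sp_conv_comp (A B D : C) (b : span_hom W B D) (a : span_hom W A B) :
  sp_conv (sp_comp b a) = sp_comp (sp_conv a) (sp_conv b).
Proof.
rewrite -(repr_cls a) -(repr_cls b) sp_compE !sp_convE sp_compE.
exact: span_comp_flip.
Qed.

Definition is_map (A B : C) (r : span_hom W A B) : Prop :=
  sp_le (sp_id A) (sp_comp (sp_conv r) r) /\
  sp_le (sp_comp r (sp_conv r)) (sp_id B).

Lemma is_map_id (A : C) : is_map (sp_id A).
Proof.
by rewrite /is_map sp_conv_id sp_comp_idl; split; apply: sp_le_refl.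
Qed.

Lemma is_map_comp (A B D : C) (s : span_hom W B D) (r : span_hom W A B) :
  is_map s -> is_map r -> is_map (sp_comp s r).
Proof.
move=> [s1 s2] [r1 r2]; rewrite /is_map sp_conv_comp; split.
- apply: (sp_le_trans r1).
  rewrite -sp_comp_assoc (sp_comp_assoc (sp_conv s) s r).
  apply: sp_le_comp; first exact: sp_le_refl.
  rewrite -{1}(sp_comp_idl r).
  by apply: sp_le_comp => //; apply: sp_le_refl.
- apply: (sp_le_trans _ s2).
  rewrite -sp_comp_assoc (sp_comp_assoc r (sp_conv r) (sp_conv s)).
  apply: sp_le_comp; first exact: sp_le_refl.
  rewrite -{2}(sp_comp_idl (sp_conv s)).
  by apply: sp_le_comp => //; apply: sp_le_refl.
Qed.

End SpanCategory.

(** * Subcategories with all objects *)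

Section WideSubcategory.

Variables (C : category) (P : forall A B : C, hom A B -> Prop).
Hypotheses (P_id : forall A, P (idm A))
  (P_comp : forall (A B D : C) (g : hom B D) (f : hom A B),
      P g -> P f -> P (g ∘ f)).

Definition wide_hom (A B : C) : Type := {f : hom A B | P f}.

Definition wide_id (A : C) : wide_hom A A := exist _ (idm A) (P_id A).

Definition wide_comp (A B D : C) (g : wide_hom B D) (f : wide_hom A B)
    : wide_hom A D :=
  exist _ (proj1_sig g ∘ proj1_sig f) (P_comp (proj2_sig g) (proj2_sig f)).

Lemma wide_comp_idl (A B : C) (f : wide_hom A B) : wide_comp (wide_id B) f = f.
Proof. by apply: sig_eq; apply: comp_idl. Qed.

Lemma wide_comp_idr (A B : C) (f : wide_hom A B) : wide_comp f (wide_id A) = f.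
Proof. by apply: sig_eq; apply: comp_idr. Qed.

Lemma wide_comp_assoc (A B D E : C) (h : wide_hom D E) (g : wide_hom B D)
    (f : wide_hom A B) :
  wide_comp h (wide_comp g f) = wide_comp (wide_comp h g) f.
Proof. by apply: sig_eq; apply: comp_assoc. Qed.

Definition wide_subcategory : category :=
  @Category C wide_hom wide_id wide_comp
    wide_comp_idl wide_comp_idr wide_comp_assoc.

End WideSubcategory.

Definition MapSpan (C : category) (hC : topos C) (W : mor_class C)
    (hW : logical_class W) : category :=
  @wide_subcategory (SpanW hC hW) (@is_map C hC W)
    (is_map_id hC hW) (is_map_comp hW).

Arguments MapSpan {C} hC W hW.

(* Main.v *)
From Corelib Require Import ssreflect.
From Stdlib Require Import Relations ClassicalEpsilon.
Require Import Defs.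

(** For a logical class [W], let [F] be the set of subterminals [U] whose map to
    [1] lies in [W].  Since [W] is closed under universal quantification, a
    monomorphism [m : X -> Y] in [W] yields [U = {* | forall y, y \in X}] in
    [F], and [Y x U -> Y] factors through [m].  Being equal modulo
    [W] thus means becoming equal after multiplication by some [U] in [F].
    A map of [Span_W(T)] is a relation that is total and single-valued after such
    a restriction; as epimorphisms are regular, it is then the graph of a morphism [A x U -> B].  So
    [Map(Span_W(T))] is the localisation of [T] at the monomorphisms in [W],
    a filtered colimit of the slices [T/U], and limits, exponentials, [Omega]
    and [1 + 1] are inherited from [T].  When [b] is in [W] it becomes
    invertible, being a monomorphism. *)

Set Implicit Arguments.
Unset Strict Implicit.
Unset Printing Implicit Defensive.

(** * Monomorphisms, pullbacks and exponentials in a category *)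

Lemma compE (C : category) (A B D : C) (g : hom B D) (f : hom A B) h :
  g ∘ f = h -> forall X (x : hom X A), g ∘ (f ∘ x) = h ∘ x.
Proof. by move=> <- X x; rewrite comp_assoc. Qed.

Lemma monic_idm (C : category) (A : C) : monic (idm A).
Proof. by move=> X x y; rewrite !comp_idl. Qed.

Lemma monic_comp (C : category) (A B D : C) (g : hom B D) (f : hom A B) :
  monic g -> monic f -> monic (g ∘ f).
Proof. by move=> mg mf X x y; rewrite -!comp_assoc => /mg /mf. Qed.

Lemma monic_pullback (C : category) (A B D : C) (f : hom A D) (m : hom B D)
    (p : span A B) :
  is_pullback f m p -> monic m -> monic (lft p).
Proof.
move=> [e H] mm X x y exy.
have es : f ∘ (lft p ∘ y) = m ∘ (rgt p ∘ y) by rewrite !comp_assoc e.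
apply: (unique_eq (H (Span (lft p ∘ y) (rgt p ∘ y)) es)) => //=; split=> //.
by apply: mm; rewrite !comp_assoc -e -!comp_assoc exy.
Qed.

Lemma epic_cancel (C : category) (A B D : C) (g : hom B D) (f : hom A B) :
  epic (g ∘ f) -> epic g.
Proof. by move=> egf X x y e; apply: egf; rewrite !comp_assoc e. Qed.

Lemma is_iso_inv (C : category) (A B : C) (f : hom A B) : is_iso f ->
  exists g : hom B A, is_iso g /\ g ∘ f = idm A /\ f ∘ g = idm B.
Proof. by move=> [g [gf fg]]; exists g; split=> //; exists f. Qed.

Lemma iso_epic (C : category) (A B : C) (f : hom A B) : is_iso f -> epic f.
Proof.
move=> [g [_ fg]] X x y e.
by rewrite -(comp_idr x) -(comp_idr y) -fg !comp_assoc e.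
Qed.

Lemma iso_monic (C : category) (A B : C) (f : hom A B) : is_iso f -> monic f.
Proof.
move=> [g [gf _]] X x y e.
by rewrite -(comp_idl x) -(comp_idl y) -gf -!comp_assoc e.
Qed.

(** A morphism of the localisation comes from the topos after precomposition with an isomorphism;
    this reduces pullbacks of such morphisms to pullbacks in the topos. *)
Lemma pullback_legs_iso (C : category) (A A' B B' D : C) (f : hom A D)
    (g : hom B D) (a : hom A' A) (b : hom B' B) (p : span A' B') :
  is_iso a -> is_iso b -> is_pullback (f ∘ a) (g ∘ b) p ->
  is_pullback f g (Span (a ∘ lft p) (b ∘ rgt p)).
Proof.
move=> ia ib [e Hp].
have [a' [a'a aa']] := ia; have [b' [b'b bb']] := ib.
split=> [|[X x y] /= exy]; first by rewrite /= !comp_assoc.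
have [|u [[/= u1 u2] uu]] := Hp (Span (a' ∘ x) (b' ∘ y)).
  by rewrite /= -!comp_assoc (compE aa') (compE bb') !comp_idl.
exists u; split=> [|v [v1 v2]].
  by rewrite -!comp_assoc u1 u2 (compE aa') (compE bb') !comp_idl.
apply: uu; rewrite -v1 -v2 -!comp_assoc.
by rewrite (compE a'a) (compE b'b) !comp_idl.
Qed.

Lemma pullback_apex_iso (C : category) (A B D : C) (f : hom A D) (g : hom B D)
    (p : span A B) (X : C) (u : hom X (apex p)) :
  is_iso u -> is_pullback f g p -> is_pullback f g (Span (lft p ∘ u) (rgt p ∘ u)).
Proof.
move=> [v [vu uv]] [e Hp]; split=> [|s es]; first by rewrite /= !comp_assoc e.
have [w [[w1 w2] ww]] := Hp s es.
exists (v ∘ w); split=> /= [|w' [w1' w2']].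
  by rewrite -!comp_assoc !(compE uv) !comp_idl.
rewrite (ww (u ∘ w')) ?comp_assoc ?vu ?comp_idl //.
Qed.

Lemma product_pullback (C : category) (I A B : C) (f : hom A I) (g : hom B I)
    (p : span A B) : is_terminal I -> is_product p <-> is_pullback f g p.
Proof.
move=> HI; split=> [Hp|[_ Hp] s].
  by split=> [|s _]; [apply: (unique_eq (HI _)) | apply: Hp].
by apply: Hp; apply: (unique_eq (HI _)).
Qed.

(** The universal property speaks of all products of [X] and [A], but any two are isomorphic, so one
    for each [X] is enough. *)
Lemma exponential_chosen (C : category) (A B E : C) (P : span E A)
    (ev : hom (apex P) B) : is_product P ->
  (forall X, exists Q0 : span X A, is_product Q0 /\
    forall h : hom (apex Q0) B,
    exists! k : hom X E, exists kx1 : hom (apex Q0) (apex P),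
      lft P ∘ kx1 = k ∘ lft Q0 /\ rgt P ∘ kx1 = rgt Q0 /\ ev ∘ kx1 = h) ->
  is_exponential ev.
Proof.
move=> HP H; split=> // X Q h HQ; have [Q0 [HQ0 {}H]] := H X.
have [u [[u1 u2] _]] := HQ Q0; have [v [[v1 v2] _]] := HQ0 Q.
have uv : u ∘ v = idm _.
  by apply: (unique_eq (HQ Q)); rewrite ?comp_idr // !comp_assoc ?u1 ?u2.
have [k [[l [l1 [l2 l3]]] kk]] := H (h ∘ u).
exists k; split=> [|k' [l' [l1' [l2' l3']]]].
  exists (l ∘ v); rewrite !comp_assoc l1 l2 l3 -!comp_assoc v1.
  by rewrite uv comp_idr.
apply: kk; exists (l' ∘ u).
by rewrite !comp_assoc l1' l2' l3' -!comp_assoc u1.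
Qed.

Lemma classifies_factor (C : category) (I Om X Y Z : C) (t : hom I Om)
    (m : hom X Y) (c : hom Y Om) (a : hom Z Y) : classifies t m c ->
  ((exists b, c ∘ a = t ∘ b) <-> exists x, m ∘ x = a).
Proof.
move=> [x [/= e H]]; split=> [[b eb]|[z <-]].
  by have [u [[/= u1 _] _]] := H (Span a b) eb; exists u.
by exists (x ∘ z); rewrite !comp_assoc e.
Qed.

(** * Predicates on generalized elements *)

Section Topos.

Variables (T : category) (hT : topos T).

(** * Binary products *)

Definition prod (A B : T) : T := apex (product hT A B).
Definition p1 (A B : T) : hom (prod A B) A := lft (product hT A B).
Definition p2 (A B : T) : hom (prod A B) B := rgt (product hT A B).
Definition pr (A B X : T) (f : hom X A) (g : hom X B) : hom X (prod A B) :=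
  pairing hT (Span f g).

Arguments p1 {A B}.
Arguments p2 {A B}.

Lemma prod_p (A B : T) : is_product (Span (@p1 A B) (@p2 A B)).
Proof.
rewrite /p1 /p2; have := @productP _ hT A B.
by rewrite /prod; case: (product hT A B).
Qed.

Arguments prod_p : clear implicits.

Lemma p1_pr (A B X : T) (f : hom X A) (g : hom X B) : p1 ∘ pr f g = f.
Proof. exact: (proj1 (pairP hT (Span f g))). Qed.

Lemma p2_pr (A B X : T) (f : hom X A) (g : hom X B) : p2 ∘ pr f g = g.
Proof. exact: (proj2 (pairP hT (Span f g))). Qed.

Lemma pr_ext (A B X : T) (x y : hom X (prod A B)) :
  p1 ∘ x = p1 ∘ y -> p2 ∘ x = p2 ∘ y -> x = y.
Proof.
move=> e1 e2.
by apply: (unique_eq (@productP _ hT _ _ (Span (p1 ∘ y) (p2 ∘ y)))).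
Qed.

Lemma pr_comp (A B X Y : T) (f : hom X A) (g : hom X B) (x : hom Y X) :
  pr f g ∘ x = pr (f ∘ x) (g ∘ x).
Proof.
by apply: pr_ext; rewrite comp_assoc ?p1_pr ?p2_pr.
Qed.

Lemma pr_eta (A B X : T) (x : hom X (prod A B)) : x = pr (p1 ∘ x) (p2 ∘ x).
Proof. by apply: pr_ext; rewrite ?p1_pr ?p2_pr. Qed.

Lemma p1_prE (A B X Y : T) (f : hom X A) (g : hom X B) (x : hom Y X) :
  p1 ∘ (pr f g ∘ x) = f ∘ x.
Proof. by rewrite comp_assoc p1_pr. Qed.

Lemma p2_prE (A B X Y : T) (f : hom X A) (g : hom X B) (x : hom Y X) :
  p2 ∘ (pr f g ∘ x) = g ∘ x.
Proof. by rewrite comp_assoc p2_pr. Qed.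

Definition prE := (p1_prE, p2_prE, p1_pr, p2_pr).

(** * Truth values and comprehension *)

Definition classifier_sig :
  {I : T & {Om : T & {t : hom I Om | is_subobject_classifier t}}}.
Proof.
have [I HI] := constructive_indefinite_description _ (topos_classifier hT).
have [Om HOm] := constructive_indefinite_description _ HI.
by have [t Ht] := constructive_indefinite_description _ HOm; exists I, Om, t.
Qed.

Definition One : T := projT1 classifier_sig.
Definition Om : T := projT1 (projT2 classifier_sig).
Definition tr : hom One Om := proj1_sig (projT2 (projT2 classifier_sig)).

Lemma trP : is_subobject_classifier tr.
Proof. exact: (proj2_sig (projT2 (projT2 classifier_sig))). Qed.

Definition bang (X : T) : hom X One :=
  proj1_sig (constructive_indefinite_description _ (proj1 trP X)).

Lemma to_One (X : T) (f g : hom X One) : f = g.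
Proof. exact: (unique_eq (proj1 trP X)). Qed.

Lemma bang_comp (X Y : T) (f : hom X Y) : bang Y ∘ f = bang X.
Proof. exact: to_One. Qed.

Lemma monic_One (X : T) (x : hom One X) : monic x.
Proof. by move=> Y y z _; apply: to_One. Qed.

(* [locked], so that rewriting with associativity does not split [tt]. *)
Definition tt (X : T) : hom X Om := locked (tr ∘ bang X).

Lemma ttE (X : T) : tt X = tr ∘ bang X.
Proof. by rewrite /tt -lock. Qed.

Lemma tt_comp (X Y : T) (f : hom X Y) : tt Y ∘ f = tt X.
Proof. by rewrite !ttE -comp_assoc bang_comp. Qed.

Lemma classifiesP (X Y : T) (m : hom X Y) (p : hom Y Om) :
  monic m ->
  (classifies tr m p <->
   forall V (y : hom V Y), p ∘ y = tt V <-> exists x, m ∘ x = y).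
Proof.
move=> mm; split=> [[b [/= e H]] V y|H].
  rewrite ttE; split=> [ey|[x <-]].
    have [u [[/= u1 _] _]] := H (Span y (bang V)) ey.
    by exists u.
  by rewrite comp_assoc e -comp_assoc (to_One (b ∘ x) (bang V)).
exists (bang X); split=> /= [|s es].
  by rewrite -ttE; apply/H; exists (idm X); rewrite comp_idr.
have [|x ex] := proj1 (H _ (lft s)).
  by rewrite ttE es (to_One (rgt s) (bang _)).
exists x; split=> [|x' [ex' _]]; last by apply: mm; rewrite ex.
by split=> //; apply: to_One.
Qed.

Lemma chi_exists (X Y : T) (m : hom X Y) : monic m ->
  exists p : hom Y Om, forall V (y : hom V Y),
    p ∘ y = tt V <-> exists x, m ∘ x = y.
Proof.
move=> mm; have [p [/(classifiesP _ mm) Hp _]] := proj2 trP _ _ _ mm.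
by exists p.
Qed.

Lemma comprehension (X : T) (p : hom X Om) :
  exists (S : T) (m : hom S X), monic m /\
    forall V (x : hom V X), p ∘ x = tt V <-> exists s, m ∘ s = x.
Proof.
have [q Hq] := topos_pullback hT p tr.
have mq : monic (lft q) by apply: (monic_pullback Hq); apply: monic_One.
exists (apex q), (lft q); split=> //; apply/classifiesP => //.
by exists (rgt q); case: (q) Hq.
Qed.

Lemma pred_ext (X : T) (p q : hom X Om) :
  (forall V (x : hom V X), p ∘ x = tt V <-> q ∘ x = tt V) -> p = q.
Proof.
move=> epq; have [S [m [mm Hm]]] := comprehension p.
apply: (unique_eq (proj2 trP _ _ _ mm)); apply/classifiesP => // V x.
by rewrite -epq.
Qed.

(* [P V x] reads "the generalized element [x : V -> X] satisfies [P]". *)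
Definition pred (X : T) := forall V, hom V X -> Prop.

(** Logic without syntax: a predicate is handled by its meaning at all stages, and definability says
    that a morphism to [Om] represents it. *)
Definition definable (X : T) (P : pred X) : Prop :=
  exists p : hom X Om, forall V (x : hom V X), P V x <-> p ∘ x = tt V.

Lemma def_ext (X : T) (P Q : pred X) :
  (forall V (x : hom V X), P V x <-> Q V x) -> definable P -> definable Q.
Proof. by move=> e [p Hp]; exists p => V x; rewrite -e. Qed.

Lemma def_true (X : T) (p : hom X Om) : definable (fun V x => p ∘ x = tt V).
Proof. by exists p. Qed.

Lemma def_monic (X Y : T) (m : hom X Y) : monic m ->
  definable (fun V y => exists x, m ∘ x = y).
Proof. by move=> /chi_exists [p Hp]; exists p => V y; rewrite Hp. Qed.

Lemma def_compr (X : T) (P : pred X) : definable P ->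
  exists (S : T) (m : hom S X), monic m /\
    forall V (x : hom V X), P V x <-> exists s, m ∘ s = x.
Proof.
move=> [p Hp]; have [S [m [mm Hm]]] := comprehension p.
by exists S, m; split=> // V x; rewrite Hp.
Qed.

Lemma def_subst (X Y : T) (f : hom X Y) (P : pred Y) :
  definable P -> definable (fun V x => P V (f ∘ x)).
Proof. by move=> [p Hp]; exists (p ∘ f) => V x; rewrite Hp comp_assoc. Qed.

Lemma def_eq (X Y : T) (f g : hom X Y) : definable (fun V x => f ∘ x = g ∘ x).
Proof.
have md : monic (pr (idm Y) (idm Y)).
  by move=> V x y /(f_equal (comp p1)); rewrite !prE !comp_idl.
apply: def_ext (def_subst (pr f g) (def_monic md)) => V x /=.
rewrite pr_comp; split=> [[y]|e]; last first.
  by exists (f ∘ x); rewrite pr_comp !comp_idl -e.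
rewrite pr_comp !comp_idl => e.
by rewrite -(p1_pr (f ∘ x) (g ∘ x)) -[RHS](p2_pr (f ∘ x) (g ∘ x)) -e !prE.
Qed.

(** Comprehension is applied twice, the second time inside the subobject given by [P]; the composite
    is the intersection. *)
Lemma def_and (X : T) (P Q : pred X) : definable P -> definable Q ->
  definable (fun V x => P V x /\ Q V x).
Proof.
move=> /def_compr [S [m [mm HP]]] /(def_subst m) /def_compr [R [n [mn HQ]]].
apply: def_ext (def_monic (monic_comp mm mn)) => V x /=; split.
  by move=> [r <-]; rewrite -comp_assoc; split; [apply/HP|apply/HQ]; eexists.
move=> [/HP [s <-]] /HQ [r <-]; exists r; by rewrite comp_assoc.
Qed.

(** Implication is the equation between [P /\ Q] and [P] as truth values. *)
Lemma def_imp (X : T) (P Q : pred X) : definable P -> definable Q ->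
  definable (fun V x => forall V' (v : hom V' V), P V' (x ∘ v) -> Q V' (x ∘ v)).
Proof.
move=> [p HP] dQ; have [q HQ] := def_and (def_true p) dQ.
apply: def_ext (def_eq q p) => V x /=; split=> [e V' v /HP Hv|H].
  by have [] := proj2 (HQ _ (x ∘ v)) _; rewrite ?comp_assoc ?e -?comp_assoc.
apply: pred_ext => V' v; rewrite -!comp_assoc -HQ; split=> [[]|e] //.
by split=> //; apply: H; apply/HP.
Qed.

(** With [E] the power object of [A], the quantified statement says that the transposes of [P] and
    of the constant true agree at [x]. *)
Lemma def_forall (X A : T) (P : pred (prod X A)) : definable P ->
  definable (fun V x => forall V' (v : hom V' V) (a : hom V' A),
                 P V' (pr (x ∘ v) a)).
Proof.
move=> [q Hq].
have [E [Pr [ev [Pp He]]]] := topos_exponential hT A Om.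
have [k [[k1 [/= k1l [k1r k1e]]] _]] := He _ _ q (prod_p X A).
have [l [[l1 [/= l1l [l1r l1e]]] _]] := He _ _ (tt _) (prod_p X A).
apply: def_ext (def_eq k l) => V x /=; split=> [e V' v a|H].
  apply/Hq; rewrite -k1e -comp_assoc.
  have -> : k1 ∘ pr (x ∘ v) a = l1 ∘ pr (x ∘ v) a; last first.
    by rewrite comp_assoc l1e tt_comp.
  have /= Hu := Pp (Span (l ∘ x ∘ v) a).
  apply: (unique_eq Hu); rewrite !comp_assoc ?k1l ?k1r ?l1l ?l1r -!comp_assoc !prE //.
  by rewrite !comp_assoc e.
have Hu := He _ _ (tt _) (prod_p V A).
apply: (unique_eq Hu).
- exists (k1 ∘ pr (x ∘ p1) p2) => /=.
  rewrite !comp_assoc k1l k1r k1e -!comp_assoc !prE; split=> //; split=> //.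
  exact/Hq.
- exists (l1 ∘ pr (x ∘ p1) p2) => /=.
  rewrite !comp_assoc l1l l1r l1e -!comp_assoc !prE; split=> //; split=> //.
  exact: tt_comp.
Qed.

Lemma def_forall_imp (X A : T) (P Q : pred (prod X A)) :
  definable P -> definable Q ->
  definable (fun V x => forall V' (v : hom V' V) (a : hom V' A),
                 P V' (pr (x ∘ v) a) -> Q V' (pr (x ∘ v) a)).
Proof.
move=> dP dQ; apply: def_ext (def_forall (def_imp dP dQ)) => V x /=.
split=> H V' v a => [Pa|V'' w].
  have := H _ v a _ (idm V'); rewrite comp_idr; exact.
by rewrite pr_comp -comp_assoc; apply: H.
Qed.

Lemma times_pullback (X X' A : T) (x : hom X' X) :
  is_pullback p1 x (Span (pr (x ∘ p1) p2 : hom (prod X' A) (prod X A)) p1).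
Proof.
split=> [|[Z b c] /= ebc]; first by rewrite /= prE.
exists (pr c (p2 ∘ b)); split; first split; rewrite /= ?prE //.
  by apply: pr_ext; rewrite !prE -?comp_assoc ?prE.
by move=> b' /= [<- <-]; apply: pr_ext; rewrite !prE.
Qed.

(** * Epimorphisms *)

(* Kripke-Joyal form of [forall b, exists a, e a = b], the existential being
   encoded by quantification over truth values. *)
Definition surj (A B : T) (e : hom A B) : Prop :=
  forall V (b : hom V B) (q : hom V Om),
    (forall V' (v : hom V' V) a, e ∘ a = b ∘ v -> q ∘ v = tt V') -> q = tt V.

(** Equality is itself a truth value and may be taken for [q]. Equations can thus be proved by
    unpacking existentials encoded through truth values. *)
Lemma eq_by_truth (V X : T) (x y : hom V X) :
  (forall q : hom V Om,
     (forall V' (v : hom V' V), x ∘ v = y ∘ v -> q ∘ v = tt V') -> q = tt V) ->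
  x = y.
Proof.
have [q Hq] := def_eq x y => /(_ q) H.
have /H : forall V' (v : hom V' V), x ∘ v = y ∘ v -> q ∘ v = tt V'.
  by move=> V' v /Hq.
by rewrite -[q]comp_idr -Hq !comp_idr.
Qed.

Lemma epic_surj (A B : T) (e : hom A B) : epic e <-> surj e.
Proof.
split=> [ee V b q H|se X x y exy]; last first.
  apply: eq_by_truth => q Hq; apply: (se _ (idm B)) => V v a.
  by rewrite comp_idl => <-; apply: Hq; rewrite !comp_assoc exy.
(* At a point [y] of [B], [r] says that [q] holds on the fibre of [b] over [y]. It is true after
   [e], and [e] is epic, so it is true. *)
have [r Hr] := def_forall_imp (def_eq (b ∘ p2) (@p1 B V)) (def_true (q ∘ p2)).
have er : r ∘ e = tt B ∘ e.
  rewrite tt_comp; apply/Hr => V' a v; rewrite -!comp_assoc !prE => ev.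
  exact: (H _ v a).
have := proj2 (Hr V b); rewrite (ee _ _ _ er) tt_comp => /(_ eq_refl V (idm V) (idm V)).
by rewrite -!comp_assoc !prE !comp_idr; apply.
Qed.

Lemma epic_pullback (A B D : T) (f : hom A D) (e : hom B D) (p : span A B) :
  is_pullback f e p -> epic e -> epic (lft p).
Proof.
move=> [ep Hp] /epic_surj se; apply/epic_surj => V a q H.
apply: (se _ (f ∘ a)) => V' v b eb.
have [|u [[/= u1 _] _]] := Hp (Span (a ∘ v) b); first by rewrite /= eb comp_assoc.
exact: (H _ _ u).
Qed.

(** The classifying morphism of [m] is true after [m], hence true since [m] is epic; so the identity
    of [B] factors through [m]. *)
Lemma monic_epic_section (A B : T) (m : hom A B) : monic m -> epic m ->
  exists s : hom B A, m ∘ s = idm B.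
Proof.
move=> mm em; have [p Hp] := chi_exists mm.
have e : p = tt B.
  apply: em; rewrite tt_comp; apply/Hp; exists (idm A); exact: comp_idr.
by apply/Hp; rewrite comp_idr.
Qed.

Lemma image_exists (A B : T) (f : hom A B) :
  exists (J : T) (e : hom A J) (m : hom J B), epic e /\ monic m /\ m ∘ e = f.
Proof.
have d := def_forall_imp (def_eq (f ∘ p2) (p1 ∘ @p1 (prod B Om) A))
                         (def_true (p2 ∘ p1)).
(* The image consists of those [y] for which every [q] with [forall a, f a = y -> q] is true, the
   second-order encoding of [exists a, f a = y]. *)
have [J [m [mm Hm]]] := def_compr (def_forall_imp d (def_true (@p2 B Om))).
have [|e He] := proj1 (Hm A f).
  move=> V a q /(_ V (idm V) a); rewrite -!comp_assoc !prE !comp_idr; exact.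
exists J, e, m; split=> //; apply/epic_surj => V j q H.
have := proj2 (Hm V (m ∘ j)) (ex_intro _ j eq_refl) V (idm V) q.
rewrite prE; apply=> V' v a; rewrite -!comp_assoc !prE comp_idr -comp_assoc => ea.
apply: (H _ v a); apply: mm.
by rewrite comp_assoc He.
Qed.

(** The third hypothesis is existence in the encoding of [surj]. The graph [G] of [P] projects to
    [B] by a monic and epic morphism, and a section of it gives [f]. *)
Lemma unique_choice (B X : T) (P : pred (prod B X)) : definable P ->
  (forall V (b : hom V B) x x', P V (pr b x) -> P V (pr b x') -> x = x') ->
  (forall V (b : hom V B) (q : hom V Om),
     (forall V' (v : hom V' V) x, P V' (pr (b ∘ v) x) -> q ∘ v = tt V') ->
     q = tt V) ->
  exists f : hom B X, forall V (b : hom V B), P V (pr b (f ∘ b)).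
Proof.
move=> dP Hu He; have [G [m [mm Hm]]] := def_compr dP.
have mG : monic (p1 ∘ m).
  move=> V x y; rewrite -!comp_assoc => e; apply: mm; apply: pr_ext => //.
  apply: (Hu _ (p1 ∘ (m ∘ y))); last by rewrite -pr_eta; apply/Hm; exists y.
  by rewrite -e -pr_eta; apply/Hm; exists x.
have eG : epic (p1 ∘ m).
  apply/epic_surj => V b q H; apply: (He _ b) => V' v x /Hm [g eg].
  by apply: (H _ v g); rewrite -comp_assoc eg prE.
have [s es] := monic_epic_section mG eG.
exists (p2 ∘ m ∘ s) => V b; apply/Hm; exists (s ∘ b).
apply: pr_ext; rewrite prE ?comp_assoc //.
by rewrite es comp_idl.
Qed.

(** Epimorphisms are regular in a topos: unique choice applies to the relation
    [forall a, e a = b -> f a = x]. *)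
Lemma epic_descent (A B X : T) (e : hom A B) (f : hom A X) : epic e ->
  (forall V (a a' : hom V A), e ∘ a = e ∘ a' -> f ∘ a = f ∘ a') ->
  exists g : hom B X, g ∘ e = f.
Proof.
move=> ee Hf; have se := proj1 (epic_surj e) ee.
have d := def_forall_imp (def_eq (e ∘ p2) (p1 ∘ @p1 (prod B X) A))
                         (def_eq (f ∘ p2) (p2 ∘ p1)).
have [||g Hg] := unique_choice d.
- move=> V b x x' H H'; apply: eq_by_truth => q Hq.
  apply: (se _ b) => V' v a ea; apply: Hq.
  have := H _ v a; have := H' _ v a.
  by rewrite -!comp_assoc !prE => -> // ->.
- move=> V b q Hq; apply: (se _ b) => V' v a ea; apply: (Hq _ v (f ∘ a)).
  move=> V'' w a'; rewrite -!comp_assoc !prE => e'.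
  rewrite -[RHS]comp_assoc; apply: Hf.
  by rewrite e' -ea comp_assoc.
- exists g; have := Hg A e A (idm A) (idm A).
  by rewrite -!comp_assoc !prE !comp_idr => ->.
Qed.

(** * Initial object and the coproduct 1 + 1 *)

(** [O] is the subterminal object where all truth values hold. Over it parallel morphisms agree and
    the hypotheses of unique choice are trivial. The form of the statement includes strictness. *)
Lemma initial_exists : exists O : T, forall V, hom V O -> is_initial V.
Proof.
have [O [m [mm Hm]]] := def_compr (def_forall (def_true (@p2 One Om))).
exists O => V o.
have all_tt V' (v : hom V' V) (q : hom V' Om) : q = tt V'.
  have := proj2 (Hm V (m ∘ o)) (ex_intro _ o eq_refl) V' v q.
  by rewrite p2_pr.
have all_eq V' (v : hom V' V) X (x y : hom V' X) : x = y.
  by apply: eq_by_truth => q _; apply: all_tt.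
move=> X; have [||f _] := unique_choice (def_true (tt (prod V X))).
- by move=> V' v *; apply: all_eq.
- by move=> V' v q _; apply: all_tt.
- exists f; split=> // g _; exact: (all_eq _ (idm V)).
Qed.

(* The object [S] is [{p | forall q, (p = true -> q) -> (p = false -> q) -> q}];
   the last clause says that [S x U] is the coproduct [U + U]. *)
Lemma bool_exists : exists (ff : hom One Om) (S : T) (b : hom S Om)
    (i j : hom One S),
  is_false tr ff /\ monic b /\ b ∘ i = tr /\ b ∘ j = ff /\
  forall U X (x y : hom U X), exists! c : hom (prod S U) X,
    c ∘ pr (i ∘ bang U) (idm U) = x /\ c ∘ pr (j ∘ bang U) (idm U) = y.
Proof.
have [O HO] := initial_exists.
have [z [_ _]] := HO O (idm O) One.
have mz : monic z.
  move=> X x y _; apply: unique_eq (HO X x O) _ _ => //.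
have [ff [Hff _]] := proj2 trP _ _ _ mz.
have noff V : tt V = ff ∘ bang V -> is_initial V.
  move=> e; have [H _] := proj1 (classifiesP ff mz) Hff V (bang V).
  by have [o _] := H (eq_sym e); apply: HO o.
have d := def_forall_imp
  (def_and (def_imp (def_true (@p1 Om Om)) (def_true p2))
           (def_imp (def_eq p1 (ff ∘ bang (prod Om Om))) (def_true p2)))
  (def_true p2).
have [S [b [mb Hb]]] := def_compr d.
have [|i bi] := proj1 (Hb One tr).
  move=> V v q [Ht _]; have := Ht V (idm V).
  rewrite !prE !comp_idr.
  by apply; rewrite ttE (to_One v (bang V)).
have [|j bj] := proj1 (Hb One ff).
  move=> V v q [_ Hf]; have := Hf V (idm V); rewrite -!comp_assoc !prE !comp_idr.
  by apply; rewrite bang_comp (to_One v (bang V)).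
(* Membership in [S], applied to [q]: a truth value holds at [s] once it holds where [s] is [i] and
   where [s] is [j]. *)
have case V (s : hom V S) (q : hom V Om) :
    (forall V' (v : hom V' V), s ∘ v = i ∘ bang V' -> q ∘ v = tt V') ->
    (forall V' (v : hom V' V), s ∘ v = j ∘ bang V' -> q ∘ v = tt V') ->
    q = tt V.
  move=> Hi Hj; have := proj2 (Hb V (b ∘ s)) (ex_intro _ s eq_refl) V (idm V) q.
  rewrite p2_pr comp_idr; apply; split=> V' v; rewrite -?comp_assoc !prE.
    by move=> e; apply: Hi; apply: mb; rewrite !comp_assoc e bi ttE.
  by rewrite bang_comp => e; apply: Hj; apply: mb; rewrite !comp_assoc e bj.
(* Where [i] and [j] agree, true equals false and the stage is initial, so the two clauses of [dG]
   below cannot conflict. *)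
have disj V : i ∘ bang V = j ∘ bang V -> is_initial V.
  by move/(f_equal (comp b)); rewrite !comp_assoc bi bj -ttE; apply: noff.
exists ff, S, b, i, j; split; first by exists O, z; split=> //; apply: HO (idm O).
split=> //; split=> //; split=> // U X x y.
have dG := def_and
  (def_imp (def_eq (p1 ∘ p1) (i ∘ bang (prod (prod S U) X)))
           (def_eq p2 (x ∘ p2 ∘ p1)))
  (def_imp (def_eq (p1 ∘ p1) (j ∘ bang (prod (prod S U) X)))
           (def_eq p2 (y ∘ p2 ∘ p1))).
have [||c Hc] := unique_choice dG.
- move=> V s a a' [Hi Hj] [Hi' Hj']; apply: eq_by_truth => q Hq.
  apply: (case _ (p1 ∘ s)) => V' v; rewrite -comp_assoc => es; apply: Hq.
    have := Hi V' v; have := Hi' V' v.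
    by rewrite -!comp_assoc !prE !bang_comp es => -> // ->.
  have := Hj V' v; have := Hj' V' v.
  by rewrite -!comp_assoc !prE !bang_comp es => -> // ->.
- move=> V s q Hq; apply: (case _ (p1 ∘ s)) => V' v es.
    apply: (Hq _ v (x ∘ p2 ∘ s ∘ v)); split=> V'' w.
      by rewrite -!comp_assoc !prE -!comp_assoc.
    rewrite -!comp_assoc !prE bang_comp !comp_assoc es -comp_assoc bang_comp.
    by move=> e; apply: (unique_eq (disj _ e X)).
  apply: (Hq _ v (y ∘ p2 ∘ s ∘ v)); split=> V'' w.
    rewrite -!comp_assoc !prE bang_comp !comp_assoc es -comp_assoc bang_comp.
    by move=> e; apply: (unique_eq (disj _ (eq_sym e) X)).
  by rewrite -!comp_assoc !prE -!comp_assoc.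
- exists c; split.
    split.
      have [Hi _] := Hc U (pr (i ∘ bang U) (idm U)).
      have := Hi U (idm U).
      by rewrite -!comp_assoc !prE !bang_comp !comp_idr; apply.
    have [_ Hj] := Hc U (pr (j ∘ bang U) (idm U)).
    have := Hj U (idm U).
    by rewrite -!comp_assoc !prE !bang_comp !comp_idr; apply.
  move=> c' [c'i c'j]; apply: eq_by_truth => q Hq.
  have eta V (k : hom One S) (v : hom V (prod S U)) : p1 ∘ v = k ∘ bang V ->
      v = pr (k ∘ bang U) (idm U) ∘ (p2 ∘ v).
    by move=> e; apply: pr_ext; rewrite !prE ?comp_idl // e -comp_assoc bang_comp.
  apply: (case _ p1) => V v es; apply: Hq.
    have [Hi _] := Hc _ v; have := Hi V (idm V).
    rewrite -!comp_assoc !prE bang_comp !comp_idr es => -> //.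
    by rewrite [in RHS](eta _ _ _ es) [RHS]comp_assoc c'i.
  have [_ Hj] := Hc _ v; have := Hj V (idm V).
  rewrite -!comp_assoc !prE bang_comp !comp_idr es => -> //.
  by rewrite [in RHS](eta _ _ _ es) [RHS]comp_assoc c'j.
Qed.

(** * Dense monomorphisms *)

Variables (W : mor_class T) (hW : logical_class W).

Definition dense (X Y : T) (m : hom X Y) : Prop := monic m /\ W m.

Lemma is_iso_idm (A : T) : is_iso (idm A).
Proof. by exists (idm A); rewrite comp_idl. Qed.

Lemma W_idm (A : T) : W (idm A).
Proof. exact: (lc_iso hW (is_iso_idm A)). Qed.

Lemma dense_comp (A B D : T) (g : hom B D) (f : hom A B) :
  dense g -> dense f -> dense (g ∘ f).
Proof.
by move=> [mg Wg] [mf Wf]; split; [apply: monic_comp | apply: (lc_comp hW)].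
Qed.

Lemma dense_pullback (A B D : T) (f : hom A D) (m : hom B D) (p : span A B) :
  is_pullback f m p -> dense m -> dense (lft p).
Proof.
by move=> Hp [mm Wm]; split; [apply: (monic_pullback Hp) | apply: (lc_pullback hW Hp)].
Qed.

Lemma dense_inverse_image (A B D : T) (f : hom A D) (m : hom B D) : dense m ->
  exists (P : T) (d : hom P A) (g : hom P B), dense d /\ f ∘ d = m ∘ g.
Proof.
move=> dm; have Hp := pullbackP hT f m.
exists _, (lft (pullback hT f m)), (rgt (pullback hT f m)).
by split; [apply: (dense_pullback Hp) | case: Hp].
Qed.

Lemma dense_meet (A B D : T) (m : hom A D) (n : hom B D) :
  dense m -> dense n ->
  exists (P : T) (d : hom P D) (a : hom P A) (b : hom P B),
    dense d /\ m ∘ a = d /\ n ∘ b = d.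
Proof.
move=> dm dn; have [P [a [b [da e]]]] := dense_inverse_image m dn.
by exists P, (m ∘ a), a, b; split; [apply: dense_comp | split].
Qed.

(** Replaces members of [W] by dense monomorphisms; the epic part can be cancelled from
    equations. *)
Lemma W_image (A B : T) (f : hom A B) : W f ->
  exists (J : T) (e : hom A J) (m : hom J B), epic e /\ dense m /\ m ∘ e = f.
Proof.
move=> Wf; have [J [e [m [ee [mm eq]]]]] := image_exists f.
exists J, e, m; split=> //; split=> //; split=> //.
by apply: (lc_mono_part hW ee mm); rewrite eq.
Qed.

Lemma dense_p1 (A U : T) : dense (bang U) -> dense (@p1 A U).
Proof.
apply: (@dense_pullback A U One (bang A) (bang U) (Span p1 p2)).
split=> /= [|s _]; first exact: to_One.
exact: prod_p.
Qed.

(* [U] is the truth value [forall y, y \in X], dense by the closure of [W]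
   under universal quantification. *)
Lemma dense_truth (X Y : T) (m : hom X Y) : dense m ->
  exists U : T, dense (bang U) /\
    forall V (u : hom V U) (y : hom V Y), exists x, m ∘ x = y.
Proof.
move=> [mm Wm].
have [U [h [mh Hh]]] := def_compr (def_forall (def_subst (@p2 One Y) (def_monic mm))).
have HU V (u : hom V U) (y : hom V Y) : exists x, m ∘ x = y.
  have [x ex] := proj2 (Hh V (h ∘ u)) (ex_intro _ u eq_refl) V (idm V) y.
  by exists x; rewrite ex p2_pr.
exists U; split=> //; rewrite (to_One (bang U) h); split=> //.
(* With [f] the identity and [g] the map to the terminal object, [forall_g f] is all of [One] and
   [forall_g m] is [h]. *)
apply: (lc_forall hW (m := m) (f := idm Y) (g := bang Y) (h := h)
          (h' := idm One)) => //; last by rewrite comp_idl.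
- exact: monic_idm.
- rewrite comp_idl; split=> // K k p mk Hp; split=> [[v ev]|[w ew]].
    by have [x <-] := HU _ (v ∘ rgt p) (lft p); exists x.
  have [|v ev] := proj1 (Hh K k); last by exists v.
  move=> V k' y; rewrite p2_pr.
  have [|u [[/= <- _] _]] := proj2 Hp (Span y k'); first exact: to_One.
  by exists (w ∘ u); rewrite comp_assoc ew.
- split=> [|K k p _ _]; first exact: monic_idm.
  by split=> _; [exists (lft p) | exists k]; rewrite comp_idl.
Qed.

(** * Spans modulo W *)

(** One peak suffices for a zigzag: two consecutive peaks are joined by a pullback, under which [W]
    is stable. *)
Lemma span_simP (A B : T) (s t : span A B) :
  span_sim W s t <->
  exists (V : T) (v : hom V (apex s)) (w : hom V (apex t)),
    W v /\ W w /\ lft s ∘ v = lft t ∘ w /\ rgt s ∘ v = rgt t ∘ w.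
Proof.
split=> [|[V [v [w [Wv [Ww [e1 e2]]]]]]]; last first.
  apply: (@rst_trans _ _ _ (Span (lft s ∘ v) (rgt s ∘ v))).
    by apply: rst_sym; apply: rst_step; exists v.
  by apply: rst_step; exists w.
elim=> {s t} [s t [w [Ww [e1 e2]]]|s|s t _ [V [v [w [Wv [Ww [e1 e2]]]]]]
             |s t r _ [V [v [w [Wv [Ww [e1 e2]]]]]]
              _ [V' [v' [w' [Wv' [Ww' [e1' e2']]]]]]].
- exists (apex s), (idm _), w; rewrite e1 e2 !comp_idr.
  by split=> //; apply: W_idm.
- by exists (apex s), (idm _), (idm _); split; [|split=> //]; apply: W_idm.
- by exists V, w, v; rewrite e1 e2.
- have Hp := pullbackP hT w v'; have [ep _] := Hp.
  exists _, (v ∘ lft (pullback hT w v')), (w' ∘ rgt (pullback hT w v')).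
  split; first by apply: (lc_comp hW) => //; apply: (lc_pullback hW Hp).
  split.
    apply: (lc_comp hW) => //.
    exact: (lc_pullback hW (pullback_flip Hp)).
  by rewrite !comp_assoc e1 e2 -e1' -e2' -!comp_assoc ep.
Qed.

Definition scl (A B X : T) (f : hom X A) (g : hom X B) : span_hom W A B :=
  scls W (Span f g).

Lemma scl_eqP (A B X Y : T) (f : hom X A) (g : hom X B)
    (f' : hom Y A) (g' : hom Y B) :
  scl f g = scl f' g' <->
  exists (V : T) (v : hom V X) (w : hom V Y),
    W v /\ W w /\ f ∘ v = f' ∘ w /\ g ∘ v = g' ∘ w.
Proof. by rewrite /scl (clsP _ _ (span_sim_equiv W A B)) span_simP. Qed.

Lemma scl_repr (A B : T) (a : span_hom W A B) :
  exists (X : T) (f : hom X A) (g : hom X B), a = scl f g.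
Proof.
exists (apex (repr a)), (lft (repr a)), (rgt (repr a)).
by rewrite /scl -[LHS]repr_cls; case: (repr a).
Qed.

Lemma scl_W (A B X Y : T) (f : hom X A) (g : hom X B) (w : hom Y X) :
  W w -> scl (f ∘ w) (g ∘ w) = scl f g.
Proof.
move=> Ww; apply/scl_eqP; exists Y, (idm Y), w.
by rewrite !comp_idr; split=> //; apply: W_idm.
Qed.

Lemma scl_comp (A B D X Y : T) (f : hom X A) (g : hom X B) (h : hom Y B)
    (k : hom Y D) (p : span X Y) :
  is_pullback g h p ->
  sp_comp hT (scl h k) (scl f g) = scl (f ∘ lft p) (k ∘ rgt p).
Proof.
move=> Hp; rewrite (sp_compE hT hW).
exact: (span_comp_any hT hW (s := Span f g) (t := Span h k) Hp).
Qed.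

Lemma scl_comp_graph (A B D X : T) (f : hom X A) (g : hom X B) (k : hom B D) :
  sp_comp hT (scl (idm B) k) (scl f g) = scl f (k ∘ g).
Proof.
by rewrite (scl_comp _ _ (pullback_flip (pullback_idl g))) /= comp_idr.
Qed.

Lemma scl_comp_cograph (A B D X : T) (f : hom B A) (g : hom X B) (k : hom X D) :
  sp_comp hT (scl g k) (scl f (idm B)) = scl (f ∘ g) k.
Proof.
by rewrite (scl_comp _ _ (pullback_idl g)) /= comp_idr.
Qed.

Lemma scl_le (A B X Y : T) (f : hom X A) (g : hom X B)
    (f' : hom Y A) (g' : hom Y B) (u : hom X Y) :
  f' ∘ u = f -> g' ∘ u = g -> sp_le hT (scl f g) (scl f' g').
Proof.
move=> e1 e2; apply/(sp_leP hT hW).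
by exists (Span f g), (Span f' g'), u.
Qed.

Lemma scl_leP (A B X Y : T) (f : hom X A) (g : hom X B)
    (f' : hom Y A) (g' : hom Y B) : sp_le hT (scl f g) (scl f' g') ->
  exists (V : T) (v : hom V X) (w : hom V Y),
    W v /\ f ∘ v = f' ∘ w /\ g ∘ v = g' ∘ w.
Proof.
move=> /(sp_leP hT hW) [s [t [u [es [et [u1 u2]]]]]].
have [V [v [w [Wv [_ [/= e1 e2]]]]]] :=
  proj1 (span_simP _ _) (proj1 (clsP _ _ (span_sim_equiv W A B)) es).
have {}et := proj1 (clsP _ _ (span_sim_equiv W A B)) (eq_sym et).
have {et} [V' [v' [w' [Wv' [_ [/= e1' e2']]]]]] :=
  proj1 (span_simP _ _) et.
have Hp := pullbackP hT (u ∘ w) v'; have [ep _] := Hp.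
exists _, (v ∘ lft (pullback hT (u ∘ w) v')), (w' ∘ rgt (pullback hT (u ∘ w) v')).
split; first by apply: (lc_comp hW) => //; apply: (lc_pullback hW Hp).
rewrite !comp_assoc e1 e2 -e1' -e2' -!comp_assoc -ep.
by rewrite -u1 -u2 -!comp_assoc.
Qed.

Lemma sp_idE (A : T) : sp_id W A = scl (idm A) (idm A).
Proof. by []. Qed.

Lemma scl_conv (A B X : T) (f : hom X A) (g : hom X B) :
  sp_conv (scl f g) = scl g f.
Proof. exact: sp_convE. Qed.

Lemma graph_is_map (A B : T) (f : hom A B) : is_map hT (scl (idm A) f).
Proof.
rewrite /is_map scl_conv !sp_idE; split.
  have Hp := pullbackP hT f f; rewrite (scl_comp _ _ Hp).
  have [|u [[u1 u2] _]] := proj2 Hp (Span (idm A) (idm A)); first by [].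
  by apply: (scl_le (u := u)); rewrite -comp_assoc comp_idl.
by rewrite scl_comp_cograph comp_idr; apply: (scl_le (u := f)); rewrite comp_idl.
Qed.

Lemma scl_monic_comp (A D : T) (d : hom D A) : monic d ->
  sp_comp hT (scl d (idm D)) (scl (idm D) d) = sp_id W D.
Proof.
move=> md; rewrite sp_idE (@scl_comp _ _ _ _ _ _ _ _ _ (Span (idm D) (idm D))) /=;
  last by rewrite !comp_idl.
split=> // -[X a b] /= e; exists a; split=> [|c [<- _]]; rewrite !comp_idl //.
by split=> //; apply: md.
Qed.

Lemma scl_dense (A D : T) (d : hom D A) : dense d ->
  sp_comp hT (scl (idm D) d) (scl d (idm D)) = sp_id W A.
Proof.
move=> [_ Wd]; rewrite scl_comp_graph comp_idr sp_idE.
by rewrite -(scl_W (idm A) (idm A) Wd) !comp_idl.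
Qed.

Lemma cograph_is_map (A D : T) (d : hom D A) : dense d ->
  is_map hT (scl d (idm D)).
Proof.
move=> dd; rewrite /is_map scl_conv scl_dense // scl_monic_comp; first by case: dd.
by split; apply: (sp_le_refl hT hW).
Qed.

Lemma map_dense_graph (A B : T) (r : span_hom W A B) : is_map hT r ->
  exists (D : T) (d : hom D A) (f : hom D B), dense d /\ r = scl d f.
Proof.
have [X [x [y ->]]] := scl_repr r; rewrite /is_map scl_conv !sp_idE => -[r1 r2].
(* Totality: the inequality for [1] yields a member of [W] that factors through [x]. *)
have [V [a [Wxa _]]] : exists (V : T) (a : hom V X), W (x ∘ a) /\ True.
  have Hp := pullbackP hT y y; rewrite (scl_comp _ _ Hp) in r1.
  have [V [v [w [Wv [e _]]]]] := scl_leP r1.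
  exists V, (lft (pullback hT y y) ∘ w); split=> //.
  by rewrite comp_assoc -e comp_idl.
(* Single-valuedness: the composites of [y] with the kernel pair of [x] agree on a dense subobject
   of it, hence everywhere over the subterminal [U]. *)
have [U [dU HU]] : exists U : T, dense (bang U) /\ forall V (u : hom V U)
    (a b : hom V X), x ∘ a = x ∘ b -> y ∘ a = y ∘ b.
  have Hp := pullbackP hT x x; rewrite (scl_comp _ _ Hp) in r2.
  have [V' [v [w [Wv [e1 e2]]]]] := scl_leP r2.
  have [K [e [m [ee [dm em]]]]] := W_image Wv.
  have em' : y ∘ lft (pullback hT x x) ∘ m = y ∘ rgt (pullback hT x x) ∘ m.
    by apply: ee; rewrite -!(comp_assoc _ m) em e1 e2.
  have [U [dU HU]] := dense_truth dm; exists U; split=> // Z u b c ebc.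
  have [k [[/= k1 k2] _]] := proj2 Hp (Span b c) ebc.
  have [l el] := HU Z u k.
  by rewrite -k1 -k2 -el !comp_assoc em'.
(* [J] is a dense domain of definition in [A]. The part [Q] of [X] over it maps onto [J], so over
   [U] the morphism [y] descends to [J x U]. *)
have [J [e [m [ee [dm em]]]]] := W_image Wxa.
have Hq := pullbackP hT x m.
move: (pullback hT x m) Hq => [Q q1 q2] Hq; have [/= eq Hq2] := Hq.
have eq2 : epic q2.
  have [|u [[_ u2] _]] := Hq2 (Span a e); first by rewrite /= em.
  by apply: (epic_cancel (f := u)); rewrite u2.
have He2 : epic (pr (q2 ∘ p1) p2 : hom (prod Q U) (prod J U)).
  exact: epic_pullback (times_pullback U q2) eq2.
have [|f ef] := epic_descent (f := y ∘ q1 ∘ p1) He2.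
  move=> Z b c /(f_equal (comp p1)); rewrite !prE -!comp_assoc => ebc.
  by apply: HU; [exact: (p2 ∘ b) | rewrite !(comp_assoc x) eq -!comp_assoc ebc].
exists (prod J U), (m ∘ p1), f; split.
  by apply: dense_comp => //; apply: dense_p1.
have [_ Wq1] := dense_pullback Hq dm.
have [_ Wp1] := dense_p1 Q dU.
(* The given span is restricted along two dense monomorphisms; the result is also the restriction of
   the fraction along an epimorphism, which lies in [W]. *)
rewrite -(scl_W x y Wq1) -(scl_W _ _ Wp1) -(scl_W (m ∘ p1) f (lc_epi hW He2)) ef.
by rewrite -comp_assoc prE /= eq -!comp_assoc.
Qed.

(** * The functor T -> Map(Span_W(T)) *)

Definition MW : category := MapSpan hT W hW.

Definition graph (A B : T) (f : hom A B) : @hom MW A B :=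
  exist _ (scl (idm A) f) (graph_is_map f).

Lemma graph_comp (A B D : T) (g : hom B D) (f : hom A B) :
  graph (g ∘ f) = graph g ∘ graph f.
Proof. by apply: sig_eq; rewrite /= scl_comp_graph. Qed.

Lemma graph_eqP (A B : T) (f g : hom A B) : graph f = graph g <->
  exists (D : T) (d : hom D A), dense d /\ f ∘ d = g ∘ d.
Proof.
split=> [/(f_equal (@proj1_sig _ _)) /= /scl_eqP|].
  move=> [V [v [w [Wv [_ [evw e]]]]]]; rewrite !comp_idl in evw; rewrite -evw in e.
  have [J [i [m [ei [dm em]]]]] := W_image Wv; exists J, m; split=> //.
  by apply: ei; rewrite -!comp_assoc em.
move=> [D [d [[_ Wd] e]]]; apply: sig_eq => /=.
by rewrite -(scl_W _ f Wd) e scl_W.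
Qed.

Lemma graph_dense_iso (A D : T) (d : hom D A) : dense d -> is_iso (graph d).
Proof.
move=> dd; exists (exist _ (scl d (idm D)) (cograph_is_map dd)).
by split; apply: sig_eq => /=; [apply: scl_monic_comp; case: dd | apply: scl_dense].
Qed.

Lemma graph_fraction (A B : T) (phi : @hom MW A B) :
  exists (D : T) (d : hom D A) (f : hom D B),
    dense d /\ phi ∘ graph d = graph f.
Proof.
case: phi => r mr; have [D [d [f [dd er]]]] := map_dense_graph mr.
exists D, d, f; split=> //; apply: sig_eq => /=; rewrite er.
have -> : scl d f = sp_comp hT (scl (idm D) f) (scl d (idm D)).
  by rewrite scl_comp_graph comp_idr.
rewrite -(sp_comp_assoc hT hW) scl_monic_comp; first by case: dd.
exact: (sp_comp_idr hT hW).
Qed.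

(** * Localisation at the dense monomorphisms *)

Section Fractions.

(** The calculus of fractions, stated for any functor with these properties: existence and equality
    of morphisms in [M] reduce to [T] up to dense monomorphisms. Spans are hidden from here on, and
    [graph] supplies the instance. *)
Variables (M : category) (ob : T -> M).
Variable loc : forall A B : T, hom A B -> @hom M (ob A) (ob B).
Hypotheses (ob_surj : forall X : M, exists A, ob A = X)
  (loc_comp : forall (A B D : T) (g : hom B D) (f : hom A B),
      loc (g ∘ f) = loc g ∘ loc f)
  (loc_eqP : forall (A B : T) (f g : hom A B), loc f = loc g <->
      exists (D : T) (d : hom D A), dense d /\ f ∘ d = g ∘ d)
  (loc_iso : forall (A D : T) (d : hom D A), dense d -> is_iso (loc d))
  (loc_fraction : forall (A B : T) (phi : @hom M (ob A) (ob B)),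
      exists (D : T) (d : hom D A) (f : hom D B),
        dense d /\ phi ∘ loc d = loc f).

Lemma loc_extend (X Y D : T) (d : hom D X) (psi : @hom M (ob D) (ob Y)) : dense d ->
  exists phi : @hom M (ob X) (ob Y), phi ∘ loc d = psi.
Proof.
move=> /loc_iso [e [ed _]].
by exists (psi ∘ e); rewrite -comp_assoc ed comp_idr.
Qed.

Lemma loc_dense_epic (X D : T) (d : hom D X) : dense d -> epic (loc d).
Proof. by move/loc_iso/iso_epic. Qed.

Lemma loc_fraction2 (X A B : T) (phi : @hom M (ob X) (ob A))
    (psi : @hom M (ob X) (ob B)) :
  exists (D : T) (d : hom D X) (f : hom D A) (g : hom D B),
    dense d /\ phi ∘ loc d = loc f /\ psi ∘ loc d = loc g.
Proof.
have [D [d [f [dd ef]]]] := loc_fraction phi.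
have [E [e [g [de eg]]]] := loc_fraction psi.
have [P [h [a [b [dh [da eb]]]]]] := dense_meet dd de.
exists P, h, (f ∘ a), (g ∘ b); split=> //.
by rewrite -{1}da -{1}eb !loc_comp !comp_assoc ef eg.
Qed.

Lemma loc_eq2 (X A B : T) (f f' : hom X A) (g g' : hom X B) :
  loc f = loc f' -> loc g = loc g' ->
  exists (D : T) (d : hom D X), dense d /\ f ∘ d = f' ∘ d /\ g ∘ d = g' ∘ d.
Proof.
move=> /loc_eqP [D [d [dd ef]]] /loc_eqP [E [e [de eg]]].
have [P [h [a [b [dh [da eb]]]]]] := dense_meet dd de.
exists P, h; split=> //.
by rewrite -{1 2}da -{1 2}eb !comp_assoc ef eg.
Qed.

(** * Finite limits in the localisation *)

Lemma loc_terminal : is_terminal (ob One).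
Proof.
move=> X'; have [X <-] := ob_surj X'; exists (loc (bang X)); split=> // phi _.
have [D [d [f [dd e]]]] := loc_fraction phi.
by apply: (loc_dense_epic dd); rewrite e -loc_comp (to_One f (bang X ∘ d)).
Qed.

(** A cone in [M] is brought to a common denominator, shrunk until its square commutes in [T],
    factored there and extended back. For uniqueness, two candidates are shrunk until their
    projections agree in [T]. *)
Lemma loc_pullback (A B D : T) (f : hom A D) (g : hom B D) (p : span A B) :
  is_pullback f g p ->
  is_pullback (loc f) (loc g) (Span (loc (lft p)) (loc (rgt p))).
Proof.
move=> [e Hp]; split=> [|[X' al be]]; first by rewrite /= -!loc_comp e.
have [X eX] := ob_surj X'; case: _ / eX al be => al be /= eab.
have [X1 [d [a [b [dd [ea eb]]]]]] := loc_fraction2 al be.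
have [|X2 [c [dc ec]]] := proj1 (loc_eqP (f ∘ a) (g ∘ b)).
  by rewrite !loc_comp -ea -eb !comp_assoc eab.
have [|u [[/= u1 u2] _]] := Hp (Span (a ∘ c) (b ∘ c)); first by rewrite /= !comp_assoc.
have [k ek] := loc_extend (loc u) (dense_comp dd dc).
have epi := loc_dense_epic (dense_comp dd dc).
exists k; split=> [|k' [k1 k2]].
  split; apply: epi; rewrite -comp_assoc ek -loc_comp ?u1 ?u2.
    by rewrite loc_comp -ea -comp_assoc -loc_comp.
  by rewrite loc_comp -eb -comp_assoc -loc_comp.
have {}k1 : loc (lft p) ∘ k = loc (lft p) ∘ k'.
  rewrite k1; apply: epi.
  by rewrite -comp_assoc ek -loc_comp u1 loc_comp -ea -comp_assoc -loc_comp.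
have {}k2 : loc (rgt p) ∘ k = loc (rgt p) ∘ k'.
  rewrite k2; apply: epi.
  by rewrite -comp_assoc ek -loc_comp u2 loc_comp -eb -comp_assoc -loc_comp.
have [Y [y [v [v' [dy [ev ev']]]]]] := loc_fraction2 k k'.
have [||Z [z [dz [z1 z2]]]] :=
  @loc_eq2 _ _ _ (lft p ∘ v) (lft p ∘ v') (rgt p ∘ v) (rgt p ∘ v').
- by rewrite !loc_comp -ev -ev' !comp_assoc k1.
- by rewrite !loc_comp -ev -ev' !comp_assoc k2.
- apply: (loc_dense_epic (dense_comp dy dz)).
  rewrite loc_comp !comp_assoc ev ev' -!loc_comp.
  have -> // : v ∘ z = v' ∘ z.
  have es : f ∘ (lft p ∘ v' ∘ z) = g ∘ (rgt p ∘ v' ∘ z) by rewrite !comp_assoc e.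
  by apply: (unique_eq (Hp (Span (lft p ∘ v' ∘ z) (rgt p ∘ v' ∘ z)) es));
    rewrite /= !comp_assoc ?z1 ?z2.
Qed.

Lemma fractions_pullback (A B D : M) (phi : hom A D) (psi : hom B D) :
  exists p : span A B, is_pullback phi psi p.
Proof.
have [A0 eA] := ob_surj A; have [B0 eB] := ob_surj B; have [D0 eD] := ob_surj D.
subst A B D.
have [A1 [a [f [da ea]]]] := loc_fraction phi.
have [B1 [b [g [db eb]]]] := loc_fraction psi.
have := loc_pullback (pullbackP hT f g); rewrite -ea -eb.
move/(pullback_legs_iso (loc_iso da) (loc_iso db)) => H.
by eexists; apply: H.
Qed.

Lemma loc_product (A B : T) (p : span A B) : is_product p ->
  is_product (Span (loc (lft p)) (loc (rgt p))).
Proof.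
move/(product_pullback (bang A) (bang B) p (proj1 trP))/loc_pullback.
by move/(product_pullback _ _ _ loc_terminal).
Qed.

Lemma fractions_product (A B : M) : exists p : span A B, is_product p.
Proof.
have [A0 <-] := ob_surj A; have [B0 <-] := ob_surj B.
by eexists; apply: (loc_product (@prod_p A0 B0)).
Qed.

(** ** Exponentials *)

Lemma dense_times (X X' A : T) (x : hom X' X) : dense x ->
  dense (pr (x ∘ p1) p2 : hom (prod X' A) (prod X A)).
Proof. exact: dense_pullback (times_pullback A x). Qed.

(** Over a dense truth value [U] the subobject is everything, so it contains the box [(X x U) x A].
    The box shape allows a morphism defined on [D] to be transposed. *)
Lemma dense_box (X A D : T) (d : hom D (prod X A)) : dense d ->
  exists (X' : T) (x : hom X' X) (l : hom (prod X' A) D),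
    dense x /\ d ∘ l = pr (x ∘ p1) p2.
Proof.
move=> dd; have [U [dU HU]] := dense_truth dd.
have [l el] := HU (prod (prod X U) A) (p2 ∘ p1) (pr (p1 ∘ p1) p2).
by exists (prod X U), p1, l; split=> //; apply: dense_p1.
Qed.

Lemma loc_exponential (A B : M) :
  exists (E : M) (P : span E A) (ev : hom (apex P) B), is_exponential ev.
Proof.
have [A0 eA] := ob_surj A; have [B0 eB] := ob_surj B; subst A B.
move: A0 B0 => A B.
have [E [P [ev [HP Hev]]]] := topos_exponential hT A B.
exists (ob E), (Span (loc (lft P)) (loc (rgt P))), (loc ev).
have HP' := loc_product HP.
apply: exponential_chosen => // X0; have [X <-] := ob_surj X0.
exists (Span (loc (@p1 X A)) (loc (@p2 X A))).
split=> [|/= h]; first exact: (loc_product (@prod_p X A)).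
(* [h] becomes a morphism of [T] on a box and is transposed there; [k] and [m] extend the transpose
   and its product with [A]. *)
have [D [d [h' [dd eh]]]] := loc_fraction h.
have [X' [x [l [dx el]]]] := dense_box dd.
have [k0 [[m0 [/= m1 [m2 m3]]] _]] := Hev _ _ (h' ∘ l) (prod_p X' A).
have dxA := dense_times A dx.
have [k ek] := loc_extend (loc k0) dx.
have [m em] := loc_extend (loc m0) dxA.
have epi := loc_dense_epic dxA.
have l1 : loc (lft P) ∘ m = k ∘ loc (@p1 X A).
  apply: epi; rewrite -!comp_assoc em -!loc_comp.
  by rewrite m1 p1_pr !loc_comp comp_assoc ek.
have l2 : loc (rgt P) ∘ m = loc (@p2 X A).
  by apply: epi; rewrite -!comp_assoc em -!loc_comp m2 p2_pr.
have l3 : loc ev ∘ m = h.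
  apply: epi; rewrite -!comp_assoc em -!loc_comp.
  by rewrite m3 -el !loc_comp comp_assoc eh.
exists k; split=> [|k' [l' /= [l1' [l2' l3']]]]; first by exists m.
have [Y [y [a1 [a2 [dy [e1 e2]]]]]] := loc_fraction2 k k'.
(* A transpose of [h] with numerator [a] on [Y] yields [b], the product of [a] with [A], whose
   evaluation equals [h] on [Y x A] in [M]. *)
have trans (a : hom Y E) (q : @hom M (ob X) (ob E))
    (n : @hom M (ob (prod X A)) (ob (apex P))) :
    loc (lft P) ∘ n = q ∘ loc (@p1 X A) ->
    loc (rgt P) ∘ n = loc (@p2 X A) -> loc ev ∘ n = h ->
    q ∘ loc y = loc a ->
    exists b : hom (prod Y A) (apex P), lft P ∘ b = a ∘ p1 /\ rgt P ∘ b = p2 /\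
      loc (ev ∘ b) = h ∘ loc (pr (y ∘ p1) p2 : hom (prod Y A) (prod X A)).
  move=> n1 n2 n3 eq.
  have [b [[/= b1 b2] _]] := HP (Span (a ∘ p1) (@p2 Y A)).
  exists b; split=> //; split=> //; rewrite loc_comp -n3 -comp_assoc; congr (_ ∘ _).
  apply: (unique_eq (HP' (Span (loc (a ∘ p1)) (loc (@p2 Y A)))));
    rewrite /= -?loc_comp ?b1 ?b2 // !comp_assoc n1 n2 -!comp_assoc -!loc_comp.
  by rewrite p1_pr p2_pr !loc_comp comp_assoc eq.
have [b1 [b1l [b1r b1e]]] := trans _ _ _ l1 l2 l3 e1.
have [b2 [b2l [b2r b2e]]] := trans _ _ _ l1' l2' l3' e2.
(* The two evaluations agree on a dense subobject of [Y x A], hence on a box [Z x A], and transposes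
   in [T] are unique. *)
have [D' [d' [dd' ed']]] := proj1 (loc_eqP _ _) (eq_trans b1e (eq_sym b2e)).
have [Z [z [n [dz en]]]] := dense_box dd'.
apply: (loc_dense_epic (dense_comp dy dz)).
rewrite loc_comp !comp_assoc e1 e2 -!loc_comp.
have -> // : a1 ∘ z = a2 ∘ z.
apply: (unique_eq (Hev _ _ (ev ∘ b1 ∘ d' ∘ n) (prod_p Z A))) => /=.
- exists (b1 ∘ d' ∘ n); rewrite -!comp_assoc en !comp_assoc b1l b1r -!comp_assoc.
  by rewrite !prE.
- exists (b2 ∘ d' ∘ n); rewrite !comp_assoc -ed' -!comp_assoc en !comp_assoc b2l b2r.
  by rewrite -!comp_assoc !prE.
Qed.

(** ** Subobject classifier *)

(** The legs of the kernel pair of the numerator become equal in [M], hence agree on a dense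
    subobject of it. Over the truth value [U] of that subobject they agree, so the numerator is
    monic on [D x U]. *)
Lemma monic_fraction (X Y : T) (phi : @hom M (ob X) (ob Y)) : monic phi ->
  exists (D : T) (d : hom D X) (m : hom D Y),
    dense d /\ monic m /\ phi ∘ loc d = loc m.
Proof.
move=> mphi; have [D [d [m [dd em]]]] := loc_fraction phi.
have mm : monic (loc m).
  by rewrite -em; apply: monic_comp => //; apply/iso_monic/loc_iso.
have Hk := pullbackP hT m m.
move: (pullback hT m m) Hk => [K k1 k2] [/= ek Hk].
have [|E [e [de ee]]] := proj1 (loc_eqP k1 k2).
  by apply: mm; rewrite -!loc_comp ek.
have [U [dU HU]] := dense_truth de.
exists (prod D U), (d ∘ p1), (m ∘ p1); split.
  by apply: dense_comp => //; apply: dense_p1.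
split; last by rewrite !loc_comp comp_assoc em.
move=> V a b; rewrite -!comp_assoc => eab.
have [k [[/= kl kr] _]] := Hk (Span (p1 ∘ a) (p1 ∘ b)) eab.
have [l el] := HU V (p2 ∘ a) k.
apply: pr_ext; first by rewrite -kl -kr -el !comp_assoc ee.
by apply: (proj1 dU); apply: to_One.
Qed.

Lemma loc_classifies (X Y : T) (m : hom X Y) (c : hom Y Om) :
  classifies tr m c -> classifies (loc tr) (loc m) (loc c).
Proof. by move=> [x /loc_pullback H]; exists (loc x). Qed.

Lemma loc_tt (X : T) : loc (tt X) = loc tr ∘ loc (bang X).
Proof. by rewrite ttE loc_comp. Qed.

(** On the subobject [N] where [a] is true, [loc d] factors through [phi], so [a'] is true there in
    [M], hence on a dense subobject of [N]. Applied in both directions, this gives uniqueness of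
    classifying morphisms. *)
Lemma classify_le (X Y D : T) (phi : @hom M (ob X) (ob Y))
    (c c' : @hom M (ob Y) (ob Om))
    (d : hom D Y) (a a' : hom D Om) :
  classifies (loc tr) phi c -> classifies (loc tr) phi c' ->
  c ∘ loc d = loc a -> c' ∘ loc d = loc a' ->
  exists U : T, dense (bang U) /\
    forall V (y : hom V D) (u : hom V U), a ∘ y = tt V -> a' ∘ y = tt V.
Proof.
move=> Hc Hc' ea ea'; have [N [n [mn Hn]]] := comprehension a.
have an : a ∘ n = tt N by apply/Hn; exists (idm N); rewrite comp_idr.
have [|be eb] := proj2 (classifies_factor (loc (d ∘ n)) Hc').
  apply/(classifies_factor _ Hc); exists (loc (bang N)).
  by rewrite loc_comp comp_assoc ea -loc_comp an loc_tt.
have [|E [e [de ee]]] := proj1 (loc_eqP (a' ∘ n) (tt N)).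
  rewrite loc_comp -ea' -comp_assoc -loc_comp eb loc_tt.
  by rewrite (unique_eq (loc_terminal (ob N)) (x := be) (y := loc (bang N))).
have [U [dU HU]] := dense_truth de.
exists U; split=> // V y u /Hn [x <-]; have [x' <-] := HU V u x.
by rewrite !comp_assoc ee !tt_comp.
Qed.

Lemma loc_classifier : is_subobject_classifier (loc tr).
Proof.
split; first exact: loc_terminal.
move=> X0 Y0; have [X <-] := ob_surj X0; have [Y <-] := ob_surj Y0 => phi mphi.
have [D [d [m [dd [mm em]]]]] := monic_fraction mphi.
have [chi [Hchi _]] := proj2 trP _ _ _ mm.
have [e [ie [de ed]]] := is_iso_inv (loc_iso dd).
have Hchi' : classifies (loc tr) phi (loc chi).
  have [x Hx] := loc_classifies Hchi.
  exists (x ∘ e); have := pullback_apex_iso (p := Span (loc m) x) ie Hx.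
  by rewrite /= -em -comp_assoc ed comp_idr.
exists (loc chi); split=> // c Hc.
have [Y' [y [a [a' [dy [ea ea']]]]]] := loc_fraction2 (loc chi) c.
have [U [dU HU]] := classify_le Hchi' Hc ea ea'.
have [U' [dU' HU']] := classify_le Hc Hchi' ea' ea.
have dUU : dense (bang (prod U U')).
  rewrite (to_One (bang _) (bang U ∘ p1)); apply: dense_comp => //.
  exact: dense_p1.
apply: (loc_dense_epic (dense_comp dy (dense_p1 Y' dUU))).
rewrite loc_comp !comp_assoc ea ea' -!loc_comp.
have -> // : a ∘ @p1 Y' (prod U U') = a' ∘ p1.
apply: pred_ext => V v; rewrite -!comp_assoc; split.
  by apply: HU; exact: (p1 ∘ (p2 ∘ v)).
by apply: HU'; exact: (p2 ∘ (p2 ∘ v)).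
Qed.

Lemma loc_topos : topos M.
Proof.
split.
- by exists (ob One); apply: loc_terminal.
- exact: fractions_product.
- exact: fractions_pullback.
- exact: loc_exponential.
- by exists (ob One), (ob Om), (loc tr); apply: loc_classifier.
Qed.

(** ** Booleanness *)

(** The denominator of a morphism from [ob O] maps to [O], so it is initial by strictness and the
    numerator is determined. *)
Lemma loc_initial (O : T) : is_initial O -> is_initial (ob O).
Proof.
move=> iO; have [O' HO'] := initial_exists.
have [o _] := iO O'.
have strict V (v : hom V O) : is_initial V by apply: HO' (o ∘ v).
move=> X0; have [X <-] := ob_surj X0; have [f _] := iO X; exists (loc f); split=> // phi _.
have [D [d [g [dd eg]]]] := loc_fraction phi.
apply: (loc_dense_epic dd); rewrite eg -loc_comp.
by rewrite (unique_eq (strict D d X) (x := f ∘ d) (y := g)).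
Qed.

(** The hypothesis speaks of every [U] because morphisms out of [ob One] are given only on a dense
    subterminal [U]; the copairing is then formed on [S x U], which is dense in [S]. *)
Lemma loc_coproduct (S : T) (i j : hom One S) :
  (forall U X (x y : hom U X), exists! c : hom (prod S U) X,
     c ∘ pr (i ∘ bang U) (idm U) = x /\ c ∘ pr (j ∘ bang U) (idm U) = y) ->
  is_coproduct (loc i) (loc j).
Proof.
move=> HS X0; have [X <-] := ob_surj X0 => f g.
have leg U (k : hom One S) : p1 ∘ pr (k ∘ bang U) (idm U) = k ∘ bang U.
  exact: p1_pr.
have [U [d [x [y [dd [ex ey]]]]]] := loc_fraction2 f g.
have dU : dense (bang U) by rewrite (to_One (bang U) d).
have [c [[ci cj] _]] := HS U X x y.
have [phi ephi] := loc_extend (loc c) (dense_p1 S dU).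
have val k : phi ∘ loc k ∘ loc d = loc (c ∘ pr (k ∘ bang U) (idm U)).
  by rewrite loc_comp -ephi -!comp_assoc -!loc_comp leg (to_One d (bang U)).
exists phi; split=> [|psi [psii psij]].
  by split; apply: (loc_dense_epic dd); rewrite val ?ci ?cj.
have phii : phi ∘ loc i = f by apply: (loc_dense_epic dd); rewrite val ci.
have phij : phi ∘ loc j = g by apply: (loc_dense_epic dd); rewrite val cj.
have [E [e [a [b [de [ea eb]]]]]] := loc_fraction2 phi psi.
(* Over [V] the denominator [E] is all of [S], so [phi] and [psi] are represented by [a ∘ l] and
   [b ∘ l] on [S x V]. *)
have [V [dV HV]] := dense_truth de.
have [l el] := HV (prod S V) p2 p1.
have shrink (k : hom One S) : phi ∘ loc k = psi ∘ loc k ->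
    loc (a ∘ l ∘ pr (k ∘ bang V) (idm V)) = loc (b ∘ l ∘ pr (k ∘ bang V) (idm V)).
  move=> ek; rewrite -!(comp_assoc _ l) !(loc_comp _ (l ∘ _)) -ea -eb.
  rewrite -!comp_assoc -!loc_comp (comp_assoc e) el leg !loc_comp !comp_assoc.
  by rewrite ek.
(* The restrictions to both summands agree in [T] over one smaller subterminal [Z], where the
   uniqueness in [HS] applies. *)
have [||Z [z [dz [zi zj]]]] := loc_eq2 (shrink i _) (shrink j _).
  by rewrite phii psii.
  by rewrite phij psij.
have sz (k : hom One S) :
    pr p1 (z ∘ p2) ∘ pr (k ∘ bang Z) (idm Z) = pr (k ∘ bang V) (idm V) ∘ z.
  by apply: pr_ext; rewrite !prE -?comp_assoc ?prE ?comp_idr ?comp_idl ?bang_comp.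
have dZ : dense (bang Z).
  by rewrite (to_One (bang Z) (bang V ∘ z)); apply: dense_comp.
apply: (loc_dense_epic (dense_p1 S dZ)).
have ep : p1 = e ∘ (l ∘ pr p1 (z ∘ p2)) :> hom (prod S Z) S.
  by rewrite comp_assoc el p1_pr.
rewrite ep loc_comp !comp_assoc ea eb -!loc_comp.
have -> // : a ∘ (l ∘ pr (@p1 S Z) (z ∘ p2)) = b ∘ (l ∘ pr p1 (z ∘ p2)).
apply: (unique_eq (HS Z X (a ∘ l ∘ pr (i ∘ bang V) (idm V) ∘ z)
                          (a ∘ l ∘ pr (j ∘ bang V) (idm V) ∘ z))).
  by rewrite -!comp_assoc !sz.
by rewrite zi zj -!comp_assoc !sz.
Qed.

Lemma loc_boolean :
  (forall (S Om' : T) (b : hom S Om'), canonical_b b -> W b) ->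
  boolean_topos M.
Proof.
move=> Wb; split; first exact: loc_topos.
have [ff [S [b [i [j [Hff [mb [bi [bj HS]]]]]]]]] := bool_exists.
exists (ob S), (ob Om), (loc b); split.
  exists (ob One), (loc tr), (loc ff), (loc i), (loc j).
  split; first exact: loc_classifier.
  split; last by split; [apply: loc_coproduct | rewrite -!loc_comp bi bj].
  have [O [z [iO Hz]]] := Hff; exists (ob O), (loc z); split.
    exact: loc_initial.
  exact: loc_classifies.
(* [b] is monic by construction, so membership in [W] makes it dense, and [loc] inverts it. *)
apply: loc_iso; split=> //; apply: Wb.
exists One, tr, ff, i, j; split; first exact: trP.
(* Taking [One] for [U] in the clause on [S] makes [S] the coproduct of two copies of [One] in
   [T]. *)
split=> //; split=> // X x y; have [c [[ci cj] cc]] := HS One X x y.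
have ek (k : hom One S) : pr (idm S) (bang S) ∘ k = pr (k ∘ bang One) (idm One).
  apply: pr_ext; rewrite !prE; last exact: to_One.
  by rewrite comp_idl (to_One (bang One) (idm One)) comp_idr.
exists (c ∘ pr (idm S) (bang S)); split.
  by rewrite -!comp_assoc !ek.
move=> c' [c'i c'j]; rewrite (cc (c' ∘ p1));
  first by rewrite -!comp_assoc !p1_pr (to_One (bang One) (idm One)) !comp_idr.
by rewrite -comp_assoc p1_pr comp_idr.
Qed.

End Fractions.

End Topos.

Theorem theorem6p3 (T : category) (hT : topos T) :
  boolean_topos (MapSpan hT (boolean_class T) (boolean_class_logical T)).
Proof.
pose hW := boolean_class_logical T.
refine (@loc_boolean T hT _ hW (MW hT hW) (fun A => A) (@graph T hT _ hW)
          _ (graph_comp hT hW) (graph_eqP hT hW) (@graph_dense_iso T hT _ hW)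
          (@graph_fraction T hT _ hW) (@boolean_class_b T)).
by move=> X; exists X.
Qed.
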